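(* Let $d\ge2$, $p\in(1,\infty)$ and $\beta\in[p-1,2p-1)$. There exists $\bar F_d\in L_p(\mathbb{R}^d_+,x_d^\beta dx)\cap C^\infty(\mathbb{R}^d_+)$ such that the following assertion holds. Let $u\in W^1_p(\mathbb{R}^d_+,x_d^\beta dx)$ be a weak solution to $$-\Delta u+u=-\sum_{i=1}^{d-1}D_iF_i-D_d\bar F_d+f\quad\text{in }\mathbb{R}^d_+$$ for some $F_1,\dots,F_{d-1},f\in L_p(\mathbb{R}^d_+,x_d^\beta dx)$. Then $u(\cdot,x_d)$ does not have a limit in $\mathcal{D}'(\mathbb{R}^{d-1})$ as $x_d\to0^+$.
   Context: $\mathbb{R}^d_+=\{x=(x',x_d):x'\in\mathbb{R}^{d-1},x_d>0\}$; $D_i=\partial_{x_i}$. $L_p(\mathbb{R}^d_+,x_d^\beta dx)$ is the weighted Lebesgue space with norm $(\int_{\mathbb{R}^d_+}|v|^px_d^\beta dx)^{1/p}$ and $W^1_p(\mathbb{R}^d_+,x_d^\beta dx)=\{u:u,Du\in L_p(\mathbb{R}^d_+,x_d^\beta dx)\}$. Weak solution means $\int_{\mathbb{R}^d_+}(Du\cdot D\varphi+u\varphi)dx=\int_{\mathbb{R}^d_+}(\sum_{i=1}^{d-1}F_iD_i\varphi+\bar F_dD_d\varphi+f\varphi)dx$ for all $\varphi\in C_0^\infty(\mathbb{R}^d_+)$. Any $u\in W^1_p(\mathbb{R}^d_+,x_d^\beta dx)$ is identified with its version for which $x_d\mapsto u(\cdot,x_d)$ belongs to $C((0,\infty);L_p(\mathbb{R}^{d-1}))$.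 *)

(* Defs.v *)
From HB Require Import structures.
From mathcomp Require Import all_boot all_order all_algebra.
From mathcomp Require Import all_classical all_reals all_analysis.

Set Implicit Arguments.
Unset Strict Implicit.
Unset Printing Implicit Defensive.
Import Order.TTheory GRing.Theory Num.Theory.
Import numFieldNormedType.Exports.
Local Open Scope classical_set_scope.
Local Open Scope ring_scope.

Definition measure_rV_display : measure_display.
Proof. exact: default_measure_display. Qed.

Section measurable_rV.
Variables (R : realType) (n : nat).

Definition rV_coord (i : 'I_n) (x : 'rV[R]_n) : R := x ord0 i.

Let rV_set0 : g_sigma_preimage rV_coord set0.
Proof. exact: sigma_algebra0. Qed.

Let rV_setC A : g_sigma_preimage rV_coord A -> g_sigma_preimage rV_coord (~` A).
Proof. exact: sigma_algebraC. Qed.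

Let rV_bigcup (F : _^nat) : (forall i, g_sigma_preimage rV_coord (F i)) ->
  g_sigma_preimage rV_coord (\bigcup_i (F i)).
Proof. exact: sigma_algebra_bigcup. Qed.

(* The sigma-algebra generated by the coordinates is the Borel one, since R^n
   is second countable. *)
HB.instance Definition _ := @isMeasurable.Build measure_rV_display
  'rV[R]_n (g_sigma_preimage rV_coord) rV_set0 rV_setC rV_bigcup.

Lemma measurable_rV_coord (i : 'I_n) :
  measurable_fun [set: 'rV[R]_n] (rV_coord i).
Proof.
move=> _ Y mY; rewrite setTI; apply: sub_sigma_algebra => /=.
rewrite -bigcup_seq/=; exists i => /=; first by rewrite mem_index_enum.
by exists Y => //; rewrite setTI.
Qed.

End measurable_rV.

Lemma measurable_fun_rV (R : realType) (n : nat) d (T : measurableType d)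
    (f : T -> 'rV[R]_n) :
  (forall i, measurable_fun [set: T] (@rV_coord R n i \o f)) ->
  measurable_fun [set: T] f.
Proof.
move=> mf.
have sub : g_sigma_preimage (fun i => @rV_coord R n i \o f) `<=` measurable.
  apply: smallest_sub; first exact: sigma_algebra_measurable.
  case: n f mf => [|m] f mf; first by rewrite big_ord0.
  rewrite -bigcup_mkord_ord; apply: bigcup_sub => i Ii.
  by move=> A [B mB <-]; exact: mf.
by move=> _ A mA; apply: sub; rewrite g_sigma_preimage_comp; exists A.
Qed.

Section lebesgue_rV.
Variable R : realType.

(* 1 + n is convertible to n.+1 *)
Definition rV_cons n (tx : R * 'rV[R]_n) : 'rV[R]_n.+1 :=
  row_mx (const_mx tx.1 : 'rV[R]_1) tx.2.

Definition rV_uncons n (x : 'rV[R]_n.+1) : R * 'rV[R]_n :=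
  (x ord0 ord0, \row_i x ord0 (lift ord0 i)).

Lemma rV_cons0 n (tx : R * 'rV[R]_n) : rV_cons tx ord0 ord0 = tx.1.
Proof.
have -> : (ord0 : 'I_n.+1) = lshift n (ord0 : 'I_1) by exact/val_inj.
by rewrite [LHS]row_mxEl mxE.
Qed.

Lemma rV_consS n (tx : R * 'rV[R]_n) i : rV_cons tx ord0 (lift ord0 i) = tx.2 ord0 i.
Proof.
have -> : lift (ord0 : 'I_n.+1) i = rshift 1 i by exact/val_inj.
by rewrite [LHS]row_mxEr.
Qed.

Lemma rV_consK n : cancel (@rV_cons n) (@rV_uncons n).
Proof.
move=> [t x]; rewrite /rV_uncons rV_cons0/=; congr pair.
by apply/rowP => i; rewrite mxE rV_consS.
Qed.

Lemma rV_unconsK n : cancel (@rV_uncons n) (@rV_cons n).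
Proof.
move=> x; apply/rowP => i; have [j ->|->] := unliftP ord0 i.
  by rewrite rV_consS mxE.
by rewrite rV_cons0.
Qed.

Lemma measurable_rV_cons n : measurable_fun [set: R * 'rV[R]_n] (@rV_cons n).
Proof.
apply: measurable_fun_rV => i; have [j ->|->] := unliftP ord0 i.
  rewrite (_ : _ \o _ = @rV_coord R n j \o snd); last first.
    by apply/funext => x /=; rewrite /rV_coord rV_consS.
  by apply: measurableT_comp => //; exact: measurable_rV_coord.
rewrite (_ : _ \o _ = fst) //.
by apply/funext => x /=; rewrite /rV_coord rV_cons0.
Qed.

Lemma measurable_rV_uncons n :
  measurable_fun [set: 'rV[R]_n.+1] (@rV_uncons n).
Proof.
apply/measurable_fun_pairP; split.
  exact: (@measurable_rV_coord R n.+1 ord0).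
apply: measurable_fun_rV => i.
rewrite (_ : _ \o _ = @rV_coord R n.+1 (lift ord0 i)).
  exact: measurable_rV_coord.
by apply/funext => x /=; rewrite /rV_coord mxE.
Qed.

Section step.
Variables (n : nat) (mu : {sigma_finite_measure set 'rV[R]_n -> \bar R}).
Local Open Scope ereal_scope.

Definition cons_measure : set 'rV[R]_n.+1 -> \bar R :=
  pushforward (@lebesgue_measure R \x mu) (@rV_cons n).

Let mcons := @measurable_rV_cons n.

Let cons_measure0 : cons_measure set0 = 0.
Proof. by rewrite /cons_measure /pushforward preimage_set0 measure0. Qed.

Let cons_measure_ge0 A : 0 <= cons_measure A.
Proof. by rewrite /cons_measure /pushforward. Qed.

Let cons_measure_sigma_additive : semi_sigma_additive cons_measure.
Proof.
move=> F mF tF mUF; rewrite /cons_measure /pushforward preimage_bigcup.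
apply: measure_semi_sigma_additive.
- by move=> k; rewrite -[X in measurable X]setTI; exact: mcons.
- apply/trivIsetP => /= i j _ _ ij; rewrite -preimage_setI.
  by move/trivIsetP : tF => /(_ _ _ _ _ ij) ->//; rewrite preimage_set0.
- by rewrite -preimage_bigcup -[X in measurable X]setTI; exact: mcons.
Qed.

HB.instance Definition _ := isMeasure.Build _ _ _ cons_measure
  cons_measure0 cons_measure_ge0 cons_measure_sigma_additive.

Let cons_measure_sigma_finite : sigma_finite setT cons_measure.
Proof.
have /sigma_finiteP[F [TF ndF Foo]] := sigma_finiteT (@lebesgue_measure R).
have /sigma_finiteP[G [TG ndG Goo]] := sigma_finiteT mu.
exists (fun k => @rV_uncons n @^-1` (F k `*` G k)).
  rewrite -preimage_bigcup; apply/seteqP; split => // x _ /=.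
  have : setT (rV_uncons x).1 by [].
  have : setT (rV_uncons x).2 by [].
  rewrite {1}TF TG => -[k _ Gk] [l _ Fl]; exists (maxn k l) => //; split.
    by move: Fl; apply/subsetPset/ndF/leq_maxr.
  by move: Gk; apply/subsetPset/ndG/leq_maxl.
move=> k; have [mF Fk] := Foo k; have [mG Gk] := Goo k; split.
  rewrite -[X in measurable X]setTI; apply: measurable_rV_uncons => //.
  exact: measurableX.
rewrite /cons_measure /pushforward -comp_preimage.
rewrite (_ : _ \o _ = id); last by apply/funext => x /=; rewrite rV_consK.
by rewrite preimage_id product_measure1E// lte_mul_pinfty// ge0_fin_numE.
Qed.

HB.instance Definition _ := Measure_isSigmaFinite.Build _ _ _ cons_measure
  cons_measure_sigma_finite.

End step.

(* Lebesgue measure on R^n, by iterated products; on R^0 it is the unit mass *)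
Fixpoint lebesgue_rV n : {sigma_finite_measure set 'rV[R]_n -> \bar R} :=
  if n is m.+1 then cons_measure (lebesgue_rV m) else \d_ (0 : 'rV[R]_0).

Lemma lebesgue_rV_box n (A : 'I_n -> set R) : (forall i, measurable (A i)) ->
  lebesgue_rV n [set x | forall i, A i (x ord0 i)] =
  (\prod_(i < n) lebesgue_measure (A i))%E.
Proof.
elim: n A => [|n IH] A mA.
  by rewrite big_ord0 /= diracE mem_set//= => -[].
have mB : measurable
    [set x : 'rV[R]_n | forall i : 'I_n, A (lift ord0 i) (x ord0 i)].
  rewrite (_ : mkset _ = \bigcap_(i in [set: 'I_n])
      (@rV_coord R n i @^-1` A (lift ord0 i))).
    apply: fin_bigcap_measurable => // i _.
    by rewrite -[X in measurable X]setTI; exact: measurable_rV_coord.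
  by apply/seteqP; split => x /= h i => [_|]; exact: h.
rewrite big_ord_recl -(IH (fun i => A (lift ord0 i)))//.
have <- := @product_measure1E _ _ _ _ R lebesgue_measure (lebesgue_rV n) _ _
  (mA ord0) mB.
rewrite [LHS]/= /cons_measure /pushforward.
congr (product_measure1 _ _ _); apply/seteqP; split => -[t x] /=.
  move=> h; split => [|i]; first by have := h ord0; rewrite rV_cons0.
  by have := h (lift ord0 i); rewrite rV_consS.
move=> [h0 hS] i; have [j ->|->] := unliftP ord0 i.
  by rewrite rV_consS.
by rewrite rV_cons0.
Qed.

End lebesgue_rV.
Arguments lebesgue_rV R n : clear implicits.

(* C^infty functions, test functions and distributions. [e] is the family of
   coordinate directions of V and 'D_(e i) the i-th partial derivative. *)
Section smooth.
Variables (R : realType) (V : normedModType R) (I : Type) (e : I -> V).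
Implicit Types (Omega K : set V) (f phi : V -> R).

Definition iter_partial (s : seq I) f : V -> R :=
  foldr (fun i g => 'D_(e i) g) f s.

(* Omega is meant to be open *)
Definition smooth_on Omega f := forall (s : seq I) (x : V), Omega x ->
  {for x, continuous (iter_partial s f)} /\
  forall i, derivable (iter_partial s f) x (e i).

Definition supported_in K phi := forall x, ~ K x -> phi x = 0.

(* C_0^infty(Omega), extended by 0 outside Omega *)
Definition test_function Omega phi := smooth_on setT phi /\
  exists K, [/\ compact K, K `<=` Omega & supported_in K phi].

(* Elements of D'(V); only the values of T on test functions matter *)
Definition is_distribution (T : (V -> R) -> R) :=
  (forall (a : R) phi psi, test_function setT phi -> test_function setT psi ->
     T (fun x => a * phi x + psi x) = a * T phi + T psi) /\
  (forall K, compact K -> exists (C : R) (N : nat), forall phi (M : R),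
     test_function setT phi -> supported_in K phi ->
     (forall s x, (size s <= N)%N -> `|iter_partial s phi x| <= M) ->
     `|T phi| <= C * M).

End smooth.

Section half_space.
Variables (R : realType) (n : nat).
Local Notation E := ('rV[R]_n * R)%type.
Implicit Types (u v f g : E -> R) (Du : 'I_n.+1 -> E -> R) (p beta : R).

(* A point of R^n.+1 is written (x', x_d) with x' in R^n, d = n.+1 *)
Definition half_space : set E := [set x | 0 < x.2].

Definition lebesgue_half : set ('rV[R]_n * measurableTypeR R) -> \bar R :=
  (lebesgue_rV R n \x @lebesgue_measure R)%E.
HB.instance Definition _ := Measure.on lebesgue_half.

(* lift ord_max j, with j : 'I_n, is the j-th tangential direction and ord_max
   the normal one *)
Definition half_basis (i : 'I_n.+1) : E :=
  if unlift ord_max i is Some j then (delta_mx ord0 j, 0) else (0, 1).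

Local Notation test := (test_function half_basis half_space).

Definition weighted_Lp p beta v := measurable_fun half_space v /\
  (\int[lebesgue_half]_(x in half_space)
     (`|v x| `^ p * x.2 `^ beta)%:E < +oo)%E.

Definition locally_integrable_half v := forall K : set E, compact K ->
  K `<=` half_space -> lebesgue_half.-integrable K (EFin \o v).

Definition weak_gradient u Du := locally_integrable_half u /\
  forall i, locally_integrable_half (Du i) /\ forall phi, test phi ->
    \int[lebesgue_half]_(x in half_space) (u x * 'D_(half_basis i) phi x) =
    - \int[lebesgue_half]_(x in half_space) (Du i x * phi x).

Definition weighted_W1p p beta u := weighted_Lp p beta u /\
  exists Du, weak_gradient u Du /\ forall i, weighted_Lp p beta (Du i).

(* - Delta u + u = - \sum_(j < n) D_j F_j - D_d Fd + f *)
Definition weak_solution u (F : 'I_n -> E -> R) (Fd f : E -> R) :=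
  exists Du, weak_gradient u Du /\ forall phi, test phi ->
    \int[lebesgue_half]_(x in half_space)
      (\sum_(i < n.+1) Du i x * 'D_(half_basis i) phi x + u x * phi x) =
    \int[lebesgue_half]_(x in half_space)
      (\sum_(j < n) F j x * 'D_(half_basis (lift ord_max j)) phi x
       + Fd x * 'D_(half_basis ord_max) phi x + f x * phi x).

Definition slice v (t : R) : 'rV[R]_n -> R := fun x' => v (x', t).

(* v is the version of u such that t |-> v(., t) is in C((0, oo); L_p(R^n)) *)
Definition Lp_continuous_version p u v :=
  [/\ {ae lebesgue_half, forall x, half_space x -> v x = u x},
      forall t : R, 0 < t -> slice v t \in Lfun (lebesgue_rV R n) p%:E
    & forall t : R, 0 < t ->
      'N[lebesgue_rV R n]_p%:E[EFin \o (slice v s \- slice v t)%R]%E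
        @[s --> t] --> 0%E].

End half_space.
Arguments half_space {R n}.
Arguments half_basis {R n} i.

(* Convergence of v(t) in D'(R^n) as t -> 0+ *)
Definition has_distribution_limit_at0 (R : realType) (n : nat)
    (v : R -> 'rV[R]_n -> R) :=
  let e := fun j : 'I_n => delta_mx ord0 j : 'rV[R]_n in
  exists2 T : ('rV[R]_n -> R) -> R, is_distribution e T &
    forall phi, test_function e setT phi ->
      \int[lebesgue_rV R n]_x (v t x * phi x) @[t --> 0^'+] --> T phi.

(* Main.v *)
(* The force is Fd(x', t) = eta(x') g(t), with eta a plateau function and
   g(t) of order 1/(t |ln t|) at 0: g is not integrable at 0, but g^p t^beta is,
   even for beta = p - 1. Let U(t) be the integral of u(., t) eta. Testing the
   equation with eta(x') psi(t) gives
     int (eta^2)(x') g psi' = - int U psi'' + (terms in u, F, f against psi).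
   Take psi(t) = t on [2 e, b], supported in [e, 2 b], with |psi(t)| <= t and
   psi'' bounded in L^1 uniformly in e. By Young's inequality
     t |w| <= |w|^p t^beta + t^((p - beta)/(p - 1)),
   where the last power is integrable at 0 as beta < 2 p - 1, the terms in
   u, F, f stay bounded as e tends to 0. If u(., t) had a limit in D', then U
   would be bounded near 0 and the U term would stay bounded as well, whereas
   the left-hand side tends to +oo because g is not integrable at 0. *)

Require Import Defs.
From mathcomp Require Import all_boot all_order all_algebra.
From mathcomp Require Import all_classical all_reals all_analysis.
From mathcomp Require Import measurable_realfun.
From mathcomp Require Import ring lra.
Import Order.TTheory GRing.Theory Num.Theory.
Import numFieldNormedType.Exports.
Local Open Scope classical_set_scope.
Local Open Scope ring_scope.

Set Implicit Arguments.
Unset Strict Implicit.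
Unset Printing Implicit Defensive.

(** * Smooth functions of one variable *)

Section smooth_real_functions.
Context {R : realType}.
Implicit Types (D : set R) (f g : R -> R).

(** A test function equal to [t] in the bulk has [psi' = 1] and [psi'' = 0] there: it sees the full
    mass of [g], and it vanishes at 0 fast enough to be paired with functions that are controlled
    only in the degenerate weight. Cutting it off at distance [e] from 0 costs a [psi''] of size
    [1/e] on an interval of length [e]. The weighted norm of [u] does not control that term
    uniformly in [e]; the boundedness of [U] does. Nor does [psi'] have a sign: on [[e, 2 e]] and
    [[b, 2 b]] only its size is bounded, and [g(t) <= 1/t] keeps the loss on these two intervals
    below a constant. The logarithm is forced by the endpoint [beta = p - 1], where [1/t] alone
    would give the divergent integrand [t^(-p) t^(p-1) = 1/t]. Put [L = 1 + ln(1 + 1/t)], so that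
    [L' = -1/(t(1+t))]. Up to sign, [L^(-p) L'] and [L^(-1) L'] have primitives [L^(1-p)/(p-1)] and
    [ln L]; as [L >= 1] and [p > 1], the first is bounded near 0 and the second is not. *)

Fixpoint Ck (k : nat) D f : Prop :=
  if k is k'.+1
  then exists2 f', (forall x, D x -> is_derive x 1 f (f' x)) & Ck k' D f'
  else True.

(** Successive derivatives are existential witnesses, prescribed only on [D]: the closure rules go
    by induction on the order, without a formula for higher derivatives, and the values of [ln] or
    [weight] off [D] do not matter. *)
Definition Coo D f := forall k, Ck k D f.

Lemma Ck_le k D f : Ck k.+1 D f -> Ck k D f.
Proof.
by elim: k f => [//|k IH] f [f' df Cf']; exists f' => //; exact: IH.
Qed.

Lemma Ck_eq k D f g : open D -> (forall x, D x -> f x = g x) ->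
  Ck k D f -> Ck k D g.
Proof.
move=> oD fg; case: k => [//|k] [f' df Cf']; exists f' => // x Dx.
apply: near_eq_is_derive (df x Dx).
by apply: filterS (open_nbhs_nbhs (conj oD Dx)) => y /fg.
Qed.

Lemma Ck_cst k D c : Ck k D (fun=> c).
Proof.
elim: k c => [//|k IH] c; exists (fun=> 0) => // x _.
exact: is_derive_cst.
Qed.

Lemma Ck_id k D : Ck k D id.
Proof.
case: k => [//|k]; exists (fun=> 1); last exact: Ck_cst.
by move=> x _; exact: is_derive_id.
Qed.

Lemma CkD k D f g : Ck k D f -> Ck k D g -> Ck k D (fun x => f x + g x).
Proof.
elim: k f g => [//|k IH] f g [f' df Cf] [g' dg Cg].
exists (fun x => f' x + g' x) => [x Dx|]; last exact: IH.
exact: is_deriveD (df x Dx) (dg x Dx).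
Qed.

Lemma CkM k D f g : Ck k D f -> Ck k D g -> Ck k D (fun x => f x * g x).
Proof.
elim: k f g => [//|k IH] f g Cf Cg.
have [f' df Cf'] := Cf; have [g' dg Cg'] := Cg.
exists (fun x => f x * g' x + g x * f' x) => [x Dx|].
  exact: is_deriveM (df x Dx) (dg x Dx).
by apply: CkD; apply: IH => //; exact: Ck_le.
Qed.

Lemma CkV k D f : (forall x, D x -> f x != 0) ->
  Ck k D f -> Ck k D (fun x => (f x)^-1).
Proof.
move=> f0; elim: k => [//|k IH] Cf; have [f' df Cf'] := Cf.
(* The derivative [- f' / f ^ 2] is spelled with two separate copies of [f^-1], so that [CkM] and
   the induction hypothesis apply. *)
exists (fun x => (f x)^-1 * (f x)^-1 * (- 1 * f' x)) => [x Dx|].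
  apply: is_derive_eq (is_deriveV (f0 x Dx) (df x Dx)) _.
  by rewrite /= expr2 -invfM mulN1r mulrN scaleNr.
by do !apply: CkM => //; [exact/IH/Ck_le|exact/IH/Ck_le|exact: Ck_cst].
Qed.

Lemma Ck_comp k D D' f g : (forall x, D x -> D' (f x)) ->
  Ck k D' g -> Ck k D f -> Ck k D (fun x => g (f x)).
Proof.
move=> DD'; elim: k g => [//|k IH] g [g' dg Cg'] Cf; have [f' df Cf'] := Cf.
exists (fun x => g' (f x) * f' x) => [x Dx|].
  exact: (@is_derive1_comp _ _ _ x _ _ (dg _ (DD' _ Dx)) (df x Dx)).
by apply: CkM => //; apply: IH => //; exact: Ck_le.
Qed.

Lemma Ck_ln k : Ck k [set x : R | 0 < x] (@ln R).
Proof.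
case: k => [//|k]; exists (fun x => x^-1) => [x|]; first exact: is_derive1_ln.
by apply: CkV; [move=> x /= /lt0r_neq0|exact: Ck_id].
Qed.

Lemma Coo_derivable D f x : Coo D f -> D x -> derivable f x 1.
Proof. by move=> /(_ 1)[f' df _] /df[]. Qed.

Lemma Coo_derive D f : open D -> Coo D f -> Coo D (derive1 f).
Proof.
move=> oD Cf k; have [f' df Cf'] := Cf k.+1.
by apply: Ck_eq Cf' => // x /df dfx; rewrite derive1E derive_val.
Qed.

Lemma Coo_derive1n D f k : open D -> Coo D f -> Coo D (derive1n k f).
Proof.
move=> oD; elim: k f => [//|k IH] f Cf; rewrite derive1Sn.
exact/IH/Coo_derive.
Qed.

Lemma Coo_continuous D f x : Coo D f -> D x -> {for x, continuous f}.
Proof.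
move=> Cf Dx; apply/differentiable_continuous/derivable1_diffP.
exact: Coo_derivable Cf Dx.
Qed.

Lemma derive1_near_cst D f c : open D -> (forall x, D x -> f x = c) ->
  forall x, D x -> derive1 f x = 0.
Proof.
move=> oD fc x Dx; rewrite derive1E (@near_eq_derive _ _ _ _ (cst c)).
  exact: derive_cst.
by apply: filterS (open_nbhs_nbhs (conj oD Dx)) => y /fc.
Qed.

Lemma is_derive0_quadratic f (C : R) : (forall x, `|f x| <= C * x ^+ 2) ->
  is_derive (0 : R) 1 f 0.
Proof.
move=> fC; have f0 : f 0 = 0.
  apply/normr0_eq0/le_anti; rewrite normr_ge0 andbT.
  by rewrite (le_trans (fC 0))// expr0n mulr0.
(* [f x / x] serves as the slope function at 0: since [0^-1 = 0], its value there is already the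
   derivative 0. *)
apply/is_derive1_caratheodory; exists (fun x => f x / x); split.
- move=> z; rewrite f0 !subr0.
  by have [->|z0] := eqVneq z 0; [rewrite mulr0; exact: f0|rewrite divfK].
- change (f x / x @[x --> (0:R)] --> f 0 / 0); rewrite f0 mul0r.
  apply/cvgr0Pnorm_le => e e0 /=.
  near=> x; have [->|x0] := eqVneq x 0; first by rewrite [f _]f0 mul0r normr0 ltW.
  rewrite normrM normfV ler_pdivrMr ?normr_gt0// (le_trans (fC x))//.
  rewrite -real_normK ?num_real// expr2 mulrA ler_wpM2r//.
  apply: (@le_trans _ _ (`|C| * `|x|)); first by rewrite ler_wpM2r// ler_norm.
  rewrite (@le_trans _ _ ((`|C| + 1) * `|x|))//.
    by rewrite ler_wpM2r// lerDl.
  rewrite -ler_pdivlMl ?ltr_wpDl// mulrC; near: x.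
  by apply: (@nbhs0_le R R^o); rewrite divr_gt0// ltr_wpDl.
- by rewrite f0 mul0r.
Unshelve. all: by end_near. Qed.

(** The factor [x^-1 ^+ k] is carried along because the family is then closed under differentiation
    up to linear combinations, so that one induction proves smoothness for all [k]. *)
Definition flat (k : nat) (x : R) : R :=
  if 0 < x then x^-1 ^+ k * expR (- x^-1) else 0.

Lemma flat_ge0 k x : 0 <= flat k x.
Proof.
rewrite /flat; case: ifPn => // x0.
by rewrite mulr_ge0 ?expR_ge0 ?exprn_ge0 ?invr_ge0 ?ltW.
Qed.

Lemma flat_gt0 k x : 0 < x -> 0 < flat k x.
Proof.
by move=> x0; rewrite /flat x0 mulr_gt0 ?expR_gt0 ?exprn_gt0 ?invr_gt0.
Qed.

Lemma flat_eq0 k x : x <= 0 -> flat k x = 0.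
Proof. by rewrite /flat leNgt => /negbTE ->. Qed.

(** With [y = 1 / x], the exponential series gives [y ^ (k + 2) <= (k + 2)! * exp y]. The spare
    factor [x ^ 2] settles the derivative at 0. *)
Lemma flat_le k x : `|flat k x| <= k.+2`!%:R * x ^+ 2.
Proof.
rewrite ger0_norm ?flat_ge0//; have [x0|x0] := leP x 0.
  by rewrite flat_eq0// mulr_ge0// sqr_ge0.
rewrite /flat x0; set y := x^-1; have y0 : 0 < y by rewrite invr_gt0.
rewrite expRN ler_pdivrMr ?expR_gt0//.
have := expR_ge1Dxn k.+1 (ltW y0) => h.
have {}h : y ^+ k.+2 <= k.+2`!%:R * expR y.
  rewrite mulrC -ler_pdivrMr ?ltr0n ?fact_gt0//.
  by apply: le_trans h; rewrite lerDr.
have -> : y ^+ k = y ^+ k.+2 * x ^+ 2.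
  rewrite -addn2 exprD -mulrA -exprMn /y mulVf ?expr1n ?mulr1//; exact: lt0r_neq0.
by rewrite [leRHS]mulrAC; apply: ler_wpM2r; rewrite ?sqr_ge0.
Qed.

Lemma is_derive_flat k (x : R) :
  is_derive x 1 (flat k) (flat k.+2 x - k%:R * flat k.+1 x).
Proof.
have [x0|x0|->] := ltgtP x 0.
- rewrite !flat_eq0 ?ltW// mulr0 subr0.
  apply: (@near_eq_is_derive _ _ _ (cst (0:R))).
  by near=> y; rewrite /= flat_eq0// ltW//; near: y; exact: lt_nbhsl.
- suff : is_derive x 1 (fun y : R => y^-1 ^+ k * expR (- y^-1))
      (flat k.+2 x - k%:R * flat k.+1 x).
    apply: near_eq_is_derive.
    by near=> y; rewrite /flat ifT//; near: y; exact: lt_nbhsr.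
  have x00 : x != 0 by rewrite lt0r_neq0.
  have dV := is_deriveV x00 (is_derive_id x 1).
  have dX : is_derive x 1 (fun y : R => y^-1 ^+ k)
      (k%:R * x^-1 ^+ k.-1 * - x ^- 2).
    have := is_deriveX k dV; rewrite exprfctE => dX.
    by apply: is_derive_eq dX _; rewrite /GRing.scale /= mulr1 -mulrA.
  have dE := @is_derive1_comp _ _ _ x _ _ (is_derive_expR _) (is_deriveN dV).
  apply: is_derive_eq (is_deriveM dX dE) _.
  rewrite /flat x0 /= /GRing.scale /= -exprVn.
  case: k dX => [|k] dX; rewrite ?mul0r ?expr0 /= ?exprS; ring.
- rewrite !flat_eq0// mulr0 subr0; apply: is_derive0_quadratic; exact: flat_le.
Unshelve. all: end_near. Qed.

Lemma Coo_flat k : Coo setT (flat k).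
Proof.
move=> m; elim: m k => [//|m IH] k; eexists.
  by move=> x _; exact: is_derive_flat.
apply: CkD; first exact: IH.
apply: (@Ck_eq _ _ (fun x => - k%:R * flat k.+1 x)); first exact: openT.
  by move=> x _; rewrite mulNr.
by apply: CkM; [exact: Ck_cst|exact: IH].
Qed.

(** The quotient is smooth because the two bumps never vanish together: [x > 1] or [x < 2]. *)
Definition step (x : R) : R :=
  flat 0 (x - 1) / (flat 0 (x - 1) + flat 0 (2 - x)).

Let step_den_gt0 x : 0 < flat 0 (x - 1) + flat 0 (2 - x).
Proof.
have [x1|x1] := ltP 1 x.
  by rewrite ltr_pwDl ?flat_ge0// flat_gt0// subr_gt0.
by rewrite ltr_wpDl ?flat_ge0// flat_gt0// subr_gt0 (le_lt_trans x1)// ltr1n.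
Qed.

Lemma step_eq0 x : x <= 1 -> step x = 0.
Proof. by move=> x1; rewrite /step flat_eq0 ?mul0r// subr_le0. Qed.

Lemma step_eq1 x : 2 <= x -> step x = 1.
Proof.
move=> x2; rewrite /step.
have -> : flat 0 (2 - x) = 0 by rewrite flat_eq0// subr_le0.
rewrite addr0 divff// lt0r_neq0// flat_gt0// subr_gt0.
by rewrite (lt_le_trans _ x2)// ltr1n.
Qed.

Lemma step_ge0 x : 0 <= step x.
Proof. by rewrite divr_ge0 ?flat_ge0// ltW. Qed.

Lemma step_le1 x : step x <= 1.
Proof. by rewrite ler_pdivrMr// mul1r lerDl flat_ge0. Qed.

Lemma Coo_step : Coo setT step.
Proof.
have aff c d k : Ck k setT (fun x : R => c + d * x).
  by apply: CkD; [|apply: CkM]; [exact: Ck_cst|exact: Ck_cst|exact: Ck_id].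
have c1 k : Ck k setT (fun x => flat 0 (x - 1)).
  apply: (@Ck_comp _ setT setT) => //; first exact: Coo_flat.
  by apply: Ck_eq (aff (-1) 1 k); [exact: openT|move=> x _; rewrite mul1r addrC].
have c2 k : Ck k setT (fun x => flat 0 (2 - x)).
  apply: (@Ck_comp _ setT setT) => //; first exact: Coo_flat.
  by apply: Ck_eq (aff 2 (-1) k); [exact: openT|move=> x _; rewrite mulN1r].
move=> k; apply: CkM => //; apply: CkV; last exact: CkD.
by move=> x _; rewrite lt0r_neq0.
Qed.

End smooth_real_functions.

(** * Plateau and linear cut-off functions, with bounds on their derivatives *)

Section cutoffs.
Context {R : realType}.

Lemma Coo_affine (D : set R) (c d : R) : Coo D (fun x => c + d * x).
Proof.
by move=> k; apply: CkD; [|apply: CkM]; [exact: Ck_cst|exact: Ck_cst|exact: Ck_id].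
Qed.

Lemma Coo_comp_affine (f : R -> R) (c d : R) : Coo setT f ->
  Coo setT (fun x => f (c + d * x)).
Proof.
by move=> Cf k; apply: (@Ck_comp _ _ setT setT) => //; exact: Coo_affine.
Qed.

Lemma Coo_continuousT (f : R -> R) : Coo setT f -> continuous f.
Proof. by move=> Cf x; exact: Coo_continuous Cf _. Qed.

Lemma continuous_bounded_itv (f : R -> R) (c d : R) : continuous f ->
  exists2 C, 0 <= C & forall x, c <= x <= d -> `|f x| <= C.
Proof.
move=> cf; have [cd|dc] := leP c d; last first.
  by exists 0 => // x /andP[cx xd]; move: dc; rewrite ltNge (le_trans cx xd).
have [|m _ hm] := @EVT_max R (fun x => `|f x|) c d cd.
  apply: continuous_subspaceT => x.
  by apply: continuous_comp; [exact: cf|exact: norm_continuous].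
exists `|f m| => // x xcd; apply: hm; by rewrite in_itv.
Qed.

(** The lengths of [[2, 3]], where it is 1, and of [[1, 4]], which supports it, are the origin of
    the box measures 1 and [3 ^+ n] in the final estimates. *)
Definition plateau (x : R) : R := step x * step (5 - x).

Lemma Coo_plateau : Coo setT plateau.
Proof.
move=> k; apply: CkM; first exact: Coo_step.
apply: (@Ck_eq _ _ _ (fun x => step (5 + -1 * x))); first exact: openT.
  by move=> x _; rewrite mulN1r.
exact: Coo_comp_affine Coo_step _.
Qed.

Lemma plateau_ge0 x : 0 <= plateau x.
Proof. by rewrite mulr_ge0 ?step_ge0. Qed.

Lemma plateau_le1 x : plateau x <= 1.
Proof. by rewrite mulr_ile1 ?step_ge0 ?step_le1. Qed.

Lemma plateau_eq1 x : 2 <= x <= 3 -> plateau x = 1.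
Proof. by move=> /andP[x2 x3]; rewrite /plateau !step_eq1 ?mulr1//; lra. Qed.

Lemma plateau_eq0 x : x <= 1 \/ 4 <= x -> plateau x = 0.
Proof.
rewrite /plateau => -[x1|x4]; first by rewrite step_eq0 ?mul0r.
by rewrite (@step_eq0 _ (5 - x)) ?mulr0//; lra.
Qed.

Lemma derive1n_support (f : R -> R) (c d : R) k x :
  (forall x, ~ (c <= x <= d) -> f x = 0) ->
  ~ (c <= x <= d) -> derive1n k f x = 0.
Proof.
move=> f0; pose D : set R := [set x | x < c] `|` [set x | d < x].
have oD : open D by apply: openU; [exact: open_lt|exact: open_gt].
have DE y : D y <-> ~ (c <= y <= d).
  split=> [[] /= yc /andP[cy yd]|].
  - by move: yc; rewrite ltNge cy.
  - by move: yc; rewrite ltNge yd.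
  - by move/negP; rewrite negb_and -!ltNge => /orP[]; [left|right].
move=> /DE; elim: k x => [|k IH] x Dx; first exact/f0/DE.
exact: (derive1_near_cst oD IH).
Qed.

Lemma derive1n_bounded (f : R -> R) (c d : R) k : Coo setT f ->
  (forall x, ~ (c <= x <= d) -> f x = 0) ->
  exists2 C, 0 <= C & forall x, `|derive1n k f x| <= C.
Proof.
move=> Cf f0.
have [C C0 hC] := continuous_bounded_itv c d
  (Coo_continuousT (Coo_derive1n k openT Cf)).
exists C => // x; have [/hC//|xcd] := pselect (is_true (c <= x <= d)).
by rewrite (derive1n_support _ f0)// normr0.
Qed.

Let plateau_support x : ~ (1 <= x <= 4) -> plateau x = 0.
Proof.
move/negP; rewrite negb_and -!ltNge => /orP[] /ltW x14; apply: plateau_eq0.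
  by left.
by right.
Qed.

Lemma derive1n_plateau_eq0 k x : ~ (1 <= x <= 4) -> derive1n k plateau x = 0.
Proof. exact: derive1n_support plateau_support. Qed.

Lemma derive1n_plateau_bounded k :
  exists2 C, 0 <= C & forall x, `|derive1n k plateau x| <= C.
Proof. exact: derive1n_bounded Coo_plateau plateau_support. Qed.

(** A smooth stand-in for the identity away from 0. It is used through the rescalings
    [c * ramp (s / c)], which all have slope 1 beyond [2 * c]. *)
Definition ramp (r : R) : R := r * step r.

Lemma Coo_ramp : Coo setT ramp.
Proof. by move=> k; apply: CkM; [exact: Ck_id|exact: Coo_step]. Qed.

Lemma ramp_eq0 r : r <= 1 -> ramp r = 0.
Proof. by move=> r1; rewrite /ramp step_eq0 ?mulr0. Qed.

Lemma ramp_id r : 2 <= r -> ramp r = r.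
Proof. by move=> r2; rewrite /ramp step_eq1 ?mulr1. Qed.

Lemma ramp_le r : 0 <= r -> 0 <= ramp r <= r.
Proof.
by move=> r0; rewrite mulr_ge0 ?step_ge0//= ler_piMr ?step_le1.
Qed.

Lemma derive1_ramp_eq0 r : r < 1 -> derive1 ramp r = 0.
Proof.
apply: (@derive1_near_cst _ [set r | r < 1] ramp 0); first exact: open_lt.
by move=> x /= /ltW; exact: ramp_eq0.
Qed.

Lemma derive1_ramp_eq1 r : 2 < r -> derive1 ramp r = 1.
Proof.
move=> r2; rewrite derive1E (@near_eq_derive _ _ _ _ id) ?derive_id//.
by near=> x; rewrite ramp_id// ltW//; near: x; exact: lt_nbhsr.
Unshelve. all: end_near. Qed.

Lemma derive2_ramp_eq0 r : r < 1 \/ 2 < r -> derive1 (derive1 ramp) r = 0.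
Proof.
case; first apply: (@derive1_near_cst _ [set r | r < 1] _ 0).
- exact: open_lt.
- exact: derive1_ramp_eq0.
apply: (@derive1_near_cst _ [set r | 2 < r] _ 1); first exact: open_gt.
exact: derive1_ramp_eq1.
Qed.

Lemma ramp_bounds : exists2 C, 1 <= C & forall r, 1 <= r <= 2 ->
  `|derive1 ramp r| <= C /\ `|derive1 (derive1 ramp) r| <= C.
Proof.
have [C1 C10 h1] := continuous_bounded_itv 1 2
  (Coo_continuousT (Coo_derive1n 1 openT Coo_ramp)).
have [C2 C20 h2] := continuous_bounded_itv 1 2
  (Coo_continuousT (Coo_derive1n 2 openT Coo_ramp)).
exists (1 + C1 + C2) => [|r r12]; first by lra.
have := h1 _ r12; have := h2 _ r12; rewrite /derive1n/=; split; lra.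
Qed.

(* [cut e b s = s] on [2 e, b], and its second derivative has [L^1] norm
   bounded independently of [e]. *)
Definition cut (e b s : R) : R := e * ramp (s / e) - b * ramp (s / b).

Lemma derive1_scale (f : R -> R) (c s : R) : Coo setT f ->
  is_derive s 1 (fun s => f (s / c)) (derive1 f (s / c) / c).
Proof.
move=> Cf; have df : is_derive (s / c) 1 f (derive1 f (s / c)).
  by rewrite derive1E; apply: derivableP; exact: Coo_derivable Cf _.
have dc : is_derive s 1 (fun s : R => s / c) c^-1.
  have := is_deriveZ c^-1 (is_derive_id s (1:R)).
  rewrite (_ : c^-1 \*: id = fun s => s / c); last first.
    by apply/funext => x; rewrite /= mulrC.
  by move=> d; apply: is_derive_eq d _; rewrite /GRing.scale/= mulr1.
exact: (@is_derive1_comp _ _ _ s _ _ df dc).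
Qed.

Lemma Coo_scale (f : R -> R) (c : R) : Coo setT f ->
  Coo setT (fun s => f (s / c)).
Proof.
move=> Cf k; apply: Ck_eq (Coo_comp_affine 0 c^-1 Cf k); first exact: openT.
by move=> x _; rewrite add0r mulrC.
Qed.

Lemma derive1_combo (f g : R -> R) (c d x f' g' : R) :
  is_derive x 1 f f' -> is_derive x 1 g g' ->
  derive1 (fun x => c * f x - d * g x) x = c * f' - d * g'.
Proof.
move=> df dg; rewrite derive1E.
by have [_ ->] := is_deriveB (is_deriveZ c df) (is_deriveZ d dg).
Qed.

Section cut.
Variables (e b : R).
Hypotheses (e0 : 0 < e) (eb : 2 * e <= b).

Let b0 : 0 < b. Proof. by move: e0 eb; lra. Qed.

Lemma Coo_cut : Coo setT (cut e b).
Proof.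
move=> k; apply: CkD; first by apply: CkM; [exact: Ck_cst|exact: Coo_scale Coo_ramp _].
apply: (@Ck_eq _ _ _ (fun s => - b * ramp (s / b))); first exact: openT.
  by move=> x _; rewrite mulNr.
by apply: CkM; [exact: Ck_cst|exact: Coo_scale Coo_ramp _].
Qed.

Lemma cut_eq0 s : s <= e \/ 2 * b <= s -> cut e b s = 0.
Proof.
rewrite /cut => -[se|bs].
  rewrite !ramp_eq0 ?ler_pdivrMr ?mul1r//; first by rewrite !mulr0 subr0.
  by move: e0 eb; lra.
rewrite !ramp_id ?ler_pdivlMr//; last by move: e0 eb; lra.
by rewrite !mulrA [e * s]mulrC [b * s]mulrC !mulfK ?lt0r_neq0 ?subrr.
Qed.

Lemma cut_le s : 0 <= s -> `|cut e b s| <= s.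
Proof.
move=> s0; have h c : 0 < c -> 0 <= c * ramp (s / c) <= s.
  move=> c0; have /ramp_le/andP[h0 h1] : 0 <= s / c by rewrite divr_ge0// ltW.
  by rewrite mulr_ge0 ?(ltW c0)//= mulrC -ler_pdivlMr.
have := h _ e0; have := h _ b0; rewrite /cut ler_norml; lra.
Qed.

Lemma derive1_cut s :
  derive1 (cut e b) s = derive1 ramp (s / e) - derive1 ramp (s / b).
Proof.
rewrite (derive1_combo _ _ (derive1_scale e s Coo_ramp) (derive1_scale b s Coo_ramp)).
by rewrite ![_ * (_ / _)]mulrC !divfK ?lt0r_neq0.
Qed.

Lemma derive2_cut s : derive1 (derive1 (cut e b)) s =
  derive1 (derive1 ramp) (s / e) / e - derive1 (derive1 ramp) (s / b) / b.
Proof.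
have C1 := Coo_derive1n 1 openT Coo_ramp.
have -> : derive1 (cut e b) =
    fun s => 1 * derive1 ramp (s / e) - 1 * derive1 ramp (s / b).
  by apply/funext => x; rewrite derive1_cut !mul1r.
by rewrite (derive1_combo _ _ (derive1_scale e s C1) (derive1_scale b s C1)) !mul1r.
Qed.

Let itv_scale (c s : R) : 0 < c ->
  s \notin `[c, 2 * c] -> s / c < 1 \/ 2 < s / c.
Proof.
move=> c0; rewrite in_itv/= negb_and -!ltNge => /orP[h|h]; [left|right].
  by rewrite ltr_pdivrMr ?mul1r.
by rewrite ltr_pdivlMr.
Qed.

(** The second derivative of [c * ramp (s / c)] is [ramp'' (s / c) / c], of size [C / c] on an
    interval of length [c]: its L^1 norm is bounded independently of [c]. *)
Lemma derive2_cut_le C s :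
  (forall r, 1 <= r <= 2 ->
    `|derive1 ramp r| <= C /\ `|derive1 (derive1 ramp) r| <= C) ->
  `|derive1 (derive1 (cut e b)) s| <=
    C / e * \1_(`[e, 2 * e]) s + C / b * \1_(`[b, 2 * b]) s.
Proof.
move=> hC; rewrite derive2_cut.
have h (c : R) : 0 < c ->
    `|derive1 (derive1 ramp) (s / c) / c| <= C / c * \1_(`[c, 2 * c]) s.
  move=> c0; rewrite indicE mem_setE.
  have [sc|/(itv_scale c0) sc] /= := boolP (s \in `[c, 2 * c]%R).
    have ic : 0 < c^-1 by rewrite invr_gt0.
    rewrite mulr1 normrM (gtr0_norm ic) ler_pM2r//.
    apply: (hC _ _).2; move: sc; rewrite in_itv/= => /andP[h1 h2].
    by rewrite ler_pdivlMr ?ler_pdivrMr// mul1r h1.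
  by rewrite derive2_ramp_eq0// mul0r normr0 mulr0.
by rewrite (le_trans (ler_normB _ _))// lerD// h.
Qed.

(** The slope is 1 between the two transition intervals. Each transition may bring it down to [- C],
    and adding [C + 1] compensates for that. *)
Lemma derive1_cut_ge C s : 0 <= C ->
  (forall r, 1 <= r <= 2 ->
    `|derive1 ramp r| <= C /\ `|derive1 (derive1 ramp) r| <= C) ->
  \1_(`[2 * e, b]) s <= derive1 (cut e b) s +
    ((C + 1) * \1_(`[e, 2 * e]) s + (C + 1) * \1_(`[b, 2 * b]) s).
Proof.
move=> C0 hC; rewrite derive1_cut.
(* Three zones for each scale [c]; the nine combinations for [e] and [b] are then linear
   arithmetic. *)
have h (c : R) : 0 < c ->
    [\/ [/\ s < c, derive1 ramp (s / c) = 0 & \1_(`[c, 2 * c]) s = 0 :> R],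
        [/\ c <= s, s <= 2 * c, - C <= derive1 ramp (s / c) <= C
          & \1_(`[c, 2 * c]) s = 1 :> R]
      | [/\ 2 * c < s, derive1 ramp (s / c) = 1
          & \1_(`[c, 2 * c]) s = 0 :> R]].
  move=> c0; rewrite indicE mem_setE in_itv/=.
  have [sc|cs] := ltP s c; [apply: Or31|have [sc|sc] := leP s (2 * c)].
  - by split=> //; rewrite derive1_ramp_eq0// ltr_pdivrMr// mul1r.
  - apply: Or32; split=> //; rewrite -ler_norml; apply: (hC _ _).1.
    by rewrite ler_pdivlMr ?ler_pdivrMr// mul1r cs.
  - by apply: Or33; split=> //; rewrite derive1_ramp_eq1// ltr_pdivlMr.
have i1 : \1_(`[2 * e, b]) s = (if 2 * e <= s <= b then 1 else 0) :> R.
  by rewrite indicE mem_setE in_itv/=; case: ifP.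
rewrite {}i1; move: (h _ e0) (h _ b0) e0 eb C0.
case=> [[? -> ->]|[? ? ? ->]|[? -> ->]]; case=> [[? -> ->]|[? ? ? ->]|[? -> ->]];
  case: ifPn => [/andP[? ?]|_] ? ? ?; lra.
Qed.

End cut.
End cutoffs.

(** * The singular weight *)

Section one_dimensional_integrals.
Context {R : realType}.
Local Notation mu := (@lebesgue_measure R).

Lemma measurable_gt0 : measurable [set x : R | 0 < x].
Proof. by apply: open_measurable; exact: open_gt. Qed.

Section FTC_half_line.
Variables f F : R -> R.
Hypothesis f_ge0 : forall x : R, 0 < x -> 0 <= f x.
Hypothesis cf : forall x : R, 0 < x -> {for x, continuous f}.
Hypothesis dF : forall x : R, 0 < x -> is_derive x 1 F (f x).

Lemma FTC_gt0 a b : 0 < a -> a < b ->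
  (\int[mu]_(x in `[a, b]) (f x)%:E = (F b - F a)%:E)%E.
Proof.
move=> a0 ab.
have cF x : 0 < x -> {for x, continuous F}.
  move=> x0; apply/differentiable_continuous/derivable1_diffP.
  by have [] := dF x0.
rewrite (@continuous_FTC2 _ f F)//.
- apply: continuous_in_subspaceT => x; rewrite inE/= in_itv/= => /andP[ax _].
  by apply: cf; exact: lt_le_trans ax.
- split.
  + move=> x; rewrite in_itv/= => /andP[ax _].
    by have [] := dF (lt_trans a0 ax).
  + by apply: cvg_at_right_filter; exact: cF.
  + by apply: cvg_at_left_filter; apply: cF; exact: lt_trans ab.
- move=> x; rewrite in_itv/= => /andP[ax _].
  by rewrite derive1E; have [_ ->] := dF (lt_trans a0 ax).
Qed.

Lemma measurable_fun_gt0 : measurable_fun [set x : R | 0 < x] f.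
Proof.
apply: open_continuous_measurable_fun; first exact: open_gt.
by move=> x; rewrite inE/=; exact: cf.
Qed.

(** Monotone convergence along an exhaustion by compact intervals. The shift by 2 keeps the left
    endpoint below 1, hence strictly below [B n], as [FTC_gt0] requires. *)
Lemma integral_FTC_le (B : nat -> R) (M : R) :
  nondecreasing_seq B -> (forall n, 1 <= B n) ->
  (forall n a, 0 < a -> a < 1 -> F (B n) - F a <= M) ->
  (\int[mu]_(x in \bigcup_n [set` `[n.+2%:R^-1, B n]%R]) (f x)%:E <= M%:E)%E.
Proof.
move=> ndB B1 FM.
have n20 n : 0 < n.+2%:R^-1 :> R by rewrite invr_gt0.
have n21 n : n.+2%:R^-1 < 1 :> R by rewrite invf_lt1// ltr1n.
apply: (cvge_to_le (ge0_nondecreasing_set_cvg_integral _ _ _ _)).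
- apply/nondecreasing_seqP => n; rewrite subsetEset.
  apply: subset_itv; rewrite bnd_simp; last exact/ndB/leqnSn.
  by rewrite lef_pV2 ?posrE ?ltr0n// ler_nat.
- by move=> n; exact: measurable_itv.
- move=> n; apply/measurable_EFinP.
  apply: measurable_funS measurable_fun_gt0.
    exact: measurable_gt0.
  by move=> x /=; rewrite in_itv/= => /andP[+ _]; exact: lt_le_trans.
- move=> n x /=; rewrite in_itv/= => /andP[nx _]; rewrite lee_fin.
  by apply: f_ge0; exact: lt_le_trans nx.
apply: nearW => n; rewrite FTC_gt0//; first by rewrite lee_fin FM.
exact: lt_le_trans (B1 n).
Qed.

End FTC_half_line.

Lemma bigcup_itv_unit : \bigcup_n `[n.+2%:R^-1, 1]%classic = `]0, 1]%classic :> set R.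
Proof.
apply/seteqP; split => x /=.
  move=> [n _] /=; rewrite !in_itv/= => /andP[nx ->]; rewrite andbT.
  by apply: lt_le_trans nx; rewrite invr_gt0.
rewrite in_itv/= => /andP[x0 x1].
exists (Num.truncn x^-1) => //=; rewrite in_itv/= x1 andbT.
rewrite invf_ple ?posrE ?ltr0n//.
by rewrite (le_trans (ltW (truncnS_gt _)))// ler_nat.
Qed.

Lemma bigcup_itv_gt0 :
  \bigcup_n `[n.+2%:R^-1, n.+1%:R]%classic = [set x | 0 < x] :> set R.
Proof.
apply/seteqP; split => x /=.
  move=> [n _] /=; rewrite !in_itv/= => /andP[nx _].
  by apply: lt_le_trans nx; rewrite invr_gt0.
move=> x0; exists (maxn (Num.truncn x^-1) (Num.truncn x)) => //=.
rewrite in_itv/= invf_ple ?posrE ?ltr0n//; apply/andP; split.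
  rewrite (le_trans (ltW (truncnS_gt _)))// ler_nat ltnS.
  exact: leq_trans (leq_maxl _ _) (leqnSn _).
by rewrite (le_trans (ltW (truncnS_gt _)))// ler_nat ltnS leq_maxr.
Qed.

Lemma Coo_powR (a : R) : Coo [set x : R | 0 < x] ((@powR R) ^~ a).
Proof.
move=> k; elim: k a => [//|k IH] a; exists (fun x => a * x `^ (a - 1)).
  by move=> x; exact: is_derive1_powR.
by apply: CkM; [exact: Ck_cst|exact: IH].
Qed.

Lemma integral_powR_unit (c : R) : -1 < c ->
  (\int[mu]_(x in `]0%R, 1%R]) (x `^ c)%:E < +oo)%E.
Proof.
move=> c1; have c10 : 0 < c + 1 by lra.
rewrite -bigcup_itv_unit.
apply: le_lt_trans (ltry ((c + 1)^-1)).
apply: (@integral_FTC_le _ (fun x => (c + 1)^-1 * x `^ (c + 1)) _ _ _ (fun=> 1)) => //.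
- by move=> x _; exact: powR_ge0.
- by move=> x x0; exact: Coo_continuous (Coo_powR c) _.
- move=> x x0; have := is_deriveZ (c + 1)^-1 (@is_derive1_powR _ (c + 1) _ x0).
  by move=> d; apply: is_derive_eq d _; rewrite addrK /GRing.scale/= mulKf// lt0r_neq0.
- by move=> n a a0 _; rewrite powR1 mulr1 gerBl mulr_ge0 ?powR_ge0// invr_ge0 ltW.
Qed.

(** This is [ln (1 + 1 / t)]: it behaves like [|ln t|] at 0 but stays positive on the whole
    half-line, and its simple derivative [- 1 / (t * (1 + t))] provides explicit primitives. *)
Definition loginv (t : R) : R := ln (1 + t) - ln t.

Lemma loginv_gt0 t : 0 < t -> 0 < loginv t.
Proof.
by move=> t0; rewrite subr_gt0 ltr_ln ?posrE// ?ltrDr// addr_gt0.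
Qed.

Lemma is_derive_loginv (t : R) : 0 < t ->
  is_derive t 1 loginv (- (t * (1 + t))^-1).
Proof.
move=> t0; have t10 : 0 < 1 + t by rewrite addr_gt0.
have d1 : is_derive t 1 (fun t : R => 1 + t) 1.
  have := is_deriveD (is_derive_cst (1 : R) t 1) (is_derive_id t (1:R)).
  by move=> d; apply: is_derive_eq d _; rewrite add0r.
have d := is_deriveB (@is_derive1_comp _ _ _ t _ _ (is_derive1_ln t10) d1)
  (is_derive1_ln t0).
apply: is_derive_eq d _; rewrite mulr1; field.
by rewrite !lt0r_neq0.
Qed.

Lemma Coo_loginv : Coo [set t | 0 < t] loginv.
Proof.
move=> k; apply: CkD.
  apply: (@Ck_comp _ _ [set x : R | 0 < x] [set x : R | 0 < x] (fun t => 1 + t)).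
  - by move=> x /= x0; rewrite addr_gt0.
  - exact: Ck_ln.
  - by apply: CkD; [exact: Ck_cst|exact: Ck_id].
apply: (@Ck_eq _ _ _ (fun t => -1 * ln t)); first exact: open_gt.
  by move=> x _; rewrite mulN1r.
by apply: CkM; [exact: Ck_cst|exact: Ck_ln].
Qed.

(* Not integrable at 0, where it behaves like [1 / (t * |ln t|)], whereas
   [weight t `^ p * t `^ beta] is integrable on (0, +oo). *)
Definition weight (t : R) : R := (t * (1 + t) ^+ 2 * (1 + loginv t))^-1.

Let den_gt0 t : 0 < t -> 0 < 1 + loginv t.
Proof. by move=> t0; rewrite addr_gt0// loginv_gt0. Qed.

Lemma weight_gt0 t : 0 < t -> 0 < weight t.
Proof.
by move=> t0; rewrite invr_gt0 !mulr_gt0 ?exprn_gt0 ?den_gt0// addr_gt0.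
Qed.

Lemma Coo_weight : Coo [set t | 0 < t] weight.
Proof.
move=> k; apply: CkV.
  by move=> t /= t0; have := weight_gt0 t0; rewrite invr_gt0 => /lt0r_neq0.
apply: CkM; last by apply: CkD; [exact: Ck_cst|exact: Coo_loginv].
apply: CkM; first exact: Ck_id.
by apply: CkM; (apply: CkD; [exact: Ck_cst|exact: Ck_id]).
Qed.

(** Serves on the transition intervals [[c, 2 * c]], where it bounds the mass of [weight] by a
    constant independent of [c]. *)
Lemma weight_le t : 0 < t -> weight t <= t^-1.
Proof.
move=> t0; have t1 : 1 <= 1 + t by rewrite lerDl ltW.
have l1 : 1 <= 1 + loginv t by rewrite lerDl ltW// loginv_gt0.
have h : 0 < t * (1 + t) ^+ 2 * (1 + loginv t) by rewrite -invr_gt0 weight_gt0.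
rewrite lef_pV2 ?posrE// -mulrA ler_peMr ?(ltW t0)//.
by rewrite mulr_ege1// exprn_ege1.
Qed.

Let Coo_den : Coo [set t | 0 < t] (fun t => 1 + loginv t).
Proof. by move=> k; apply: CkD; [exact: Ck_cst|exact: Coo_loginv]. Qed.

Let Coo_tS : Coo [set t : R | 0 < t] (fun t => (t * (1 + t))^-1).
Proof.
move=> k; apply: CkV.
  by move=> t /= t0; rewrite lt0r_neq0// mulr_gt0// addr_gt0.
by apply: CkM; [exact: Ck_id|apply: CkD; [exact: Ck_cst|exact: Ck_id]].
Qed.

Let is_derive_den (t : R) : 0 < t ->
  is_derive t 1 (fun t => 1 + loginv t) (- (t * (1 + t))^-1).
Proof.
move=> t0; have := is_deriveD (is_derive_cst (1 : R) t 1) (is_derive_loginv t0).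
by move=> d; apply: is_derive_eq d _; rewrite add0r.
Qed.

(** With [L = 1 + loginv t], the right-hand side is the derivative of [L^(1 - p) / (p - 1)]. The
    square of [1 + t] in [weight] leaves enough decay at infinity for this comparison at every
    [beta] in the range. *)
Lemma weight_powR_le (p beta t : R) : 1 < p -> p - 1 <= beta < 2 * p - 1 ->
  0 < t ->
  weight t `^ p * t `^ beta <= (1 + loginv t) `^ (- p) * (t * (1 + t))^-1.
Proof.
move=> p1 /andP[b1 b2] t0; have t10 : 0 < 1 + t by rewrite addr_gt0.
have q0 := den_gt0 t0.
have -> : weight t = t `^ (-1) * (1 + t) `^ (- 2) * (1 + loginv t) `^ (-1).
  rewrite /weight !invfM !powRN !powRr1 ?(ltW t0) ?(ltW t10) ?(ltW q0)//.
  by rewrite powR_mulrn ?(ltW t10)// expr2 invfM.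
rewrite !powRM ?mulr_ge0 ?powR_ge0// -!powRrM !mulN1r mulrAC mulrC.
rewrite ler_pM2l ?powR_gt0// mulrAC -powRD; last first.
  by rewrite (lt0r_neq0 t0) implybT.
have -> : (t * (1 + t))^-1 = t `^ (-1) * (1 + t) `^ (-1).
  by rewrite invfM !powRN !powRr1 ?ltW.
(* Opaque names for the two exponents, so that [powRD] below splits off the [-1] only. *)
have [c cE] : exists c, c = beta - p + 1 by exists (beta - p + 1).
have [m mE] : exists m, m = 2 * p - 1 by exists (2 * p - 1).
have -> : - p + beta = c + -1 by rewrite cE; ring.
have -> : - 2 * p = - m + -1 by rewrite mE; ring.
rewrite !powRD ?(lt0r_neq0 t0) ?(lt0r_neq0 t10) ?implybT//.
rewrite mulrACA ler_piMl ?mulr_ge0 ?powR_ge0//.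
rewrite powRN ler_pdivrMr ?powR_gt0// mul1r.
(* [t ^ c <= (1 + t) ^ c] rests on [0 <= c], that is [p - 1 <= beta]; the next bound holds because
   [c < p < m]. *)
apply: (@le_trans _ _ ((1 + t) `^ c)).
  by apply: ge0_ler_powR; rewrite ?nnegrE; lra.
by apply: ler_powR; [rewrite lerDl ltW|rewrite cE mE; lra].
Qed.

Lemma integral_weight_powR (p beta : R) : 1 < p -> p - 1 <= beta < 2 * p - 1 ->
  (\int[mu]_(t in [set t | 0 < t]%R) (weight t `^ p * t `^ beta)%:E < +oo)%E.
Proof.
move=> p1 hb.
pose f t := (1 + loginv t) `^ (- p) * (t * (1 + t))^-1.
have f_ge0 t : 0 < t -> 0 <= f t.
  by move=> t0; rewrite mulr_ge0 ?powR_ge0// invr_ge0 mulr_ge0 ?addr_ge0 ?ltW.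
have cf t : 0 < t -> {for t, continuous f}.
  move=> t0; apply: (@Coo_continuous _ [set t | 0 < t]) => // k.
  apply: CkM; last exact: Coo_tS.
  by apply: Ck_comp (Coo_powR (- p) k) _; [exact: den_gt0|exact: Coo_den].
apply: (@le_lt_trans _ _ (\int[mu]_(t in [set t | 0 < t]%R) (f t)%:E)%E).
  have mpos := measurable_gt0.
  apply: ge0_le_integral => //.
  - by move=> t _; rewrite lee_fin mulr_ge0 ?powR_ge0.
  - apply/measurable_EFinP; apply: open_continuous_measurable_fun.
      exact: open_gt.
    move=> t; rewrite inE/= => t0.
    apply: (@Coo_continuous _ [set t | 0 < t]) => // k.
    apply: CkM; last exact: Coo_powR.
    by apply: Ck_comp (Coo_powR p k) _; [exact: weight_gt0|exact: Coo_weight].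
  - by apply/measurable_EFinP; exact: measurable_fun_gt0.
  - by move=> t t0; rewrite lee_fin weight_powR_le.
rewrite -bigcup_itv_gt0; apply: le_lt_trans (ltry ((p - 1)^-1)).
have p10 : 0 < p - 1 by rewrite subr_gt0.
apply: (@integral_FTC_le f (fun t => (p - 1)^-1 * (1 + loginv t) `^ (1 - p)) f_ge0 cf
  _ (fun n => n.+1%:R)).
- move=> t t0.
  have d1 := @is_derive1_comp _ ((@powR R) ^~ (1 - p)) _ t _ _
    (@is_derive1_powR _ (1 - p) _ (den_gt0 t0)) (is_derive_den t0).
  apply: is_derive_eq (is_deriveZ (p - 1)^-1 d1) _.
  rewrite /GRing.scale/= /f addrAC subrr add0r.
  by field; rewrite !lt0r_neq0// ?addr_gt0.
- by apply/nondecreasing_seqP => n; rewrite ler_nat.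
- by move=> n; rewrite ler1n.
- move=> n a a0 _; rewrite lerBlDr.
  (* The primitive is at most [1 / (p - 1)], since [1 + loginv] is at least 1 and the exponent
     [1 - p] is negative. *)
  apply: (@le_trans _ _ (p - 1)^-1); last first.
    by rewrite lerDl mulr_ge0 ?powR_ge0// invr_ge0 ltW.
  rewrite ler_piMr ?invr_ge0 ?(ltW p10)//.
  apply: (@le_trans _ _ ((1 + loginv n.+1%:R) `^ 0)); last by rewrite powRr0.
  apply: ler_powR.
    by rewrite lerDl ltW// loginv_gt0.
  by rewrite subr_le0 ltW.
Qed.

(** The factor 1/2 comes from [1 + t <= 2] on []0, 1]]: with [L = 1 + loginv t], half of
    [1 / (t * (1 + t) * L)] lies below [weight] and has primitive [- ln L / 2]. *)
Lemma integral_weight_ge (a b : R) : 0 < a -> a < b -> b <= 1 ->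
  (((ln (1 + loginv a) - ln (1 + loginv b)) / 2)%:E <=
   \int[mu]_(t in `[a, b]) (weight t)%:E)%E.
Proof.
move=> a0 ab b1.
pose f t := 2^-1 * ((1 + loginv t)^-1 * (t * (1 + t))^-1).
have f_ge0 t : 0 < t -> 0 <= f t.
  move=> t0; rewrite mulr_ge0// mulr_ge0// invr_ge0 ltW ?den_gt0//.
  by rewrite mulr_gt0// addr_gt0.
have cf t : 0 < t -> {for t, continuous f}.
  move=> t0; apply: (@Coo_continuous _ [set t | 0 < t]) => // k.
  apply: CkM; first exact: Ck_cst.
  apply: CkM; last exact: Coo_tS.
  apply: CkV; last exact: Coo_den.
  by move=> x /= x0; rewrite lt0r_neq0// den_gt0.
have dF (t : R) : 0 < t -> is_derive t 1 (fun t => - 2^-1 * ln (1 + loginv t)) (f t).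
  move=> t0.
  have d1 := @is_derive1_comp _ (@ln R) _ t _ _ (is_derive1_ln (den_gt0 t0))
    (is_derive_den t0).
  apply: is_derive_eq (is_deriveZ (- 2^-1) d1) _.
  by rewrite /GRing.scale/= /f mulNr !mulrN opprK.
have := FTC_gt0 cf dF a0 ab.
rewrite (_ : _ - _ = (ln (1 + loginv a) - ln (1 + loginv b)) / 2); last by field.
move=> <-; apply: ge0_le_integral => //.
- move=> t /=; rewrite in_itv/= => /andP[at_ _]; rewrite lee_fin f_ge0//.
  exact: lt_le_trans at_.
- apply/measurable_EFinP; apply: measurable_funS (measurable_fun_gt0 cf).
    exact: measurable_gt0.
  by move=> t /=; rewrite in_itv/= => /andP[+ _]; exact: lt_le_trans.
- apply/measurable_EFinP; apply: measurable_funS (measurable_fun_gt0 _).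
  + exact: measurable_gt0.
  + by move=> t /=; rewrite in_itv/= => /andP[+ _]; exact: lt_le_trans.
  + by move=> x x0; exact: Coo_continuous Coo_weight _.
- move=> t /=; rewrite in_itv/= => /andP[at_ tb]; rewrite lee_fin.
  have t0 : 0 < t by exact: lt_le_trans at_.
  have q0 := den_gt0 t0; have t10 : 0 < 1 + t by rewrite addr_gt0.
  rewrite /f /weight -!invfM lef_pV2 ?posrE ?mulr_gt0 ?exprn_gt0//.
  rewrite -subr_ge0.
  rewrite (_ : _ - _ = t * (1 + t) * (1 + loginv t) * (1 - t)); last by ring.
  by rewrite mulr_ge0 ?subr_ge0 ?(le_trans tb)// !mulr_ge0// ltW.
Qed.

Lemma loginv_unbounded (M : R) : exists2 a, 0 < a &
  forall t, 0 < t -> t <= a -> M <= ln (1 + loginv t).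
Proof.
(* A double exponential, as the divergence is only that of [ln |ln t|]: below this point
   [loginv t >= - ln t >= expR M]. *)
exists (expR (- expR M)) => [|t t0 ta]; first exact: expR_gt0.
rewrite -[leLHS]expRK ler_ln ?posrE ?expR_gt0 ?den_gt0//.
have h : expR M <= - ln t.
  by rewrite lerNr -[leRHS]expRK ler_ln ?posrE ?expR_gt0.
have : 0 <= ln (1 + t) by rewrite ln_ge0// lerDl ltW.
by rewrite /loginv; lra.
Qed.

End one_dimensional_integrals.

(** * Tensor products as test functions *)

Section tensor_functions.
Context {R : realType} {n : nat}.
Local Notation V := 'rV[R]_n.
Local Notation E := ('rV[R]_n * R)%type.
Implicit Types (k : 'I_n -> nat) (b : R -> R).

(** A directional derivative only sees the restriction to a line, so partial derivatives of tensor
    products reduce to derivatives in one variable. *)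
Lemma is_derive_line (U : normedModType R) (f : U -> R) (x v : U)
    (g : R -> R) (s df : R) :
  (forall h, f (h *: v + x) = g (h + s)) -> is_derive s 1 g df ->
  is_derive x v f df.
Proof.
move=> fg [dg g'].
have q : (fun h : R => h^-1 *: ((f \o shift x) (h *: v) - f x)) =
         (fun h : R => h^-1 *: ((g \o shift s) (h *: 1) - g s)).
  apply/funext => h /=; rewrite fg.
  have -> : f x = g s by have := fg 0; rewrite scale0r !add0r.
  by rewrite /GRing.scale /= mulr1.
apply: DeriveDef; first by rewrite /derivable q.
by rewrite /derive q.
Qed.

(** The multi-index [k] of derivation orders makes the family stable under partial derivatives: the
    [j]-th one raises [k j] by 1. The plateau function [eta] is the case [k = 0]. *)
Definition profile k (x : V) : R := \prod_(j < n) derive1n (k j) plateau (x ord0 j).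

Definition incr k (j : 'I_n) : 'I_n -> nat := fun i => ((i == j) + k i)%N.

Definition tens k b (x : E) : R := profile k x.1 * b x.2.

Local Notation e_ := (fun j : 'I_n => delta_mx ord0 j : V).

Let derive1n_plateau m (x : R) :
  is_derive x 1 (derive1n m plateau) (derive1n m.+1 plateau x).
Proof.
rewrite derive1nS derive1E; apply: derivableP.
exact: (Coo_derivable (Coo_derive1n m openT Coo_plateau)).
Qed.

Lemma profile_line k (x : V) j h : profile k (h *: e_ j + x) =
  (\prod_(i < n | i != j) derive1n (k i) plateau (x ord0 i)) *
  derive1n (k j) plateau (h + x ord0 j).
Proof.
rewrite /profile (bigD1 j)//= !mxE !eqxx mulr1 mulrC; congr (_ * _).
apply: eq_bigr => i ij.
by rewrite !mxE (negbTE ij) mulr0 add0r.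
Qed.

Lemma profile_incr k (x : V) j : profile (incr k j) x =
  (\prod_(i < n | i != j) derive1n (k i) plateau (x ord0 i)) *
  derive1n (k j).+1 plateau (x ord0 j).
Proof.
rewrite /profile (bigD1 j)//= /incr eqxx mulrC; congr (_ * _).
by apply: eq_bigr => i ij; rewrite (negbTE ij).
Qed.

Lemma is_derive_profile k (x : V) j :
  is_derive x (e_ j) (profile k) (profile (incr k j) x).
Proof.
apply: (is_derive_line (profile_line k x j)); rewrite profile_incr.
by apply: is_derive_eq (is_deriveZ _ (derive1n_plateau _ _)) _.
Qed.

Lemma profile_continuous k : continuous (profile k).
Proof.
move=> x; apply: (@continuous_big) => [y|j _ {}x].
  exact: mul_continuous.
apply: (@continuous_comp _ _ _ (fun x : V => x ord0 j)).
  exact: coord_continuous.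
exact: (Coo_continuousT (Coo_derive1n (k j) openT Coo_plateau)).
Qed.

Lemma iter_partial_profile k (s : seq 'I_n) :
  exists k', iter_partial e_ s (profile k) = profile k'.
Proof.
elim: s => [|j s [k' IH]]; first by exists k.
exists (incr k' j); rewrite /= -/(iter_partial e_ s (profile k)) IH.
by apply/funext => x; have [] := is_derive_profile k' x j.
Qed.

Lemma smooth_profile k : smooth_on e_ setT (profile k).
Proof.
move=> s x _; have [k' ->] := iter_partial_profile k s; split.
  exact: profile_continuous.
by move=> j; have [] := is_derive_profile k' x j.
Qed.

Lemma profile_eq0 k (x : V) : ~ (forall j, 1 <= x ord0 j <= 4) -> profile k x = 0.
Proof.
move=> /existsNP[j xj]; rewrite /profile (bigD1 j)//=.
by rewrite derive1n_plateau_eq0 ?mul0r.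
Qed.

Lemma compact_profile_support :
  compact [set x : V | forall j, 1 <= x ord0 j <= 4].
Proof.
rewrite (_ : mkset _ = [set x : V | forall j, `[1, 4]%classic (x ord0 j)]).
  by apply: (@rV_compact R n (fun=> `[1, 4]%classic)) => j; exact: segment_compact.
by apply/seteqP; split => x /= h j; have := h j; rewrite in_itv.
Qed.

Lemma test_profile k : test_function e_ setT (profile k).
Proof.
split; first exact: smooth_profile.
exists [set x : V | forall j, 1 <= x ord0 j <= 4]; split=> //.
  exact: compact_profile_support.
by move=> x; exact: profile_eq0.
Qed.

Lemma profile_bounded k : exists2 C, 0 <= C & forall x, `|profile k x| <= C.
Proof.
have /choice[C hC] : forall j : 'I_n, exists C : R,
    0 <= C /\ forall x, `|derive1n (k j) plateau x| <= C.
  by move=> j; have [C C0 hC] := @derive1n_plateau_bounded R (k j); exists C.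
exists (\prod_j C j); first by apply: prodr_ge0 => j _; have [] := hC j.
move=> x; rewrite normr_prod; apply: ler_prod => j _.
by rewrite normr_ge0/=; apply: (hC j).2.
Qed.

Lemma profile0_ge0 x : 0 <= profile (fun=> 0%N) x.
Proof. by apply: prodr_ge0 => j _; exact: plateau_ge0. Qed.

Lemma profile0_le1 x : profile (fun=> 0%N) x <= 1.
Proof.
have : 0 <= profile (fun=> 0%N) x <= 1; last by case/andP.
apply: (big_ind (fun y : R => 0 <= y <= 1)) => [|a b|j _].
- by rewrite ler01 lexx.
- by move=> /andP[a0 a1] /andP[b0 b1]; rewrite mulr_ge0//= mulr_ile1.
- by rewrite plateau_ge0 plateau_le1.
Qed.

Lemma profile0_eq1 (x : V) : (forall j, 2 <= x ord0 j <= 3) -> profile (fun=> 0%N) x = 1.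
Proof. by move=> h; apply: big1 => j _; exact: plateau_eq1. Qed.

Lemma measurable_profile k : measurable_fun setT (profile k).
Proof.
apply: measurable_prod => j _.
apply: (@measurableT_comp _ _ _ _ _ _ _ _ (@rV_coord R n j)).
  apply: continuous_measurable_fun.
  exact: (Coo_continuousT (Coo_derive1n (k j) openT Coo_plateau)).
exact: measurable_rV_coord.
Qed.

Lemma is_derive_tens_tangential k b (x : E) j :
  is_derive x (half_basis (lift ord_max j)) (tens k b) (tens (incr k j) b x).
Proof.
rewrite /half_basis liftK.
pose c := (\prod_(i < n | i != j) derive1n (k i) plateau (x.1 ord0 i)) * b x.2.
apply: (@is_derive_line _ _ _ _ (fun r => c * derive1n (k j) plateau r) (x.1 ord0 j)).
  by move=> h; rewrite /tens /= scaler0 add0r profile_line /c mulrAC.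
apply: is_derive_eq (is_deriveZ c (derive1n_plateau _ _)) _.
by rewrite /tens profile_incr /c /GRing.scale/= mulrAC.
Qed.

Lemma is_derive_tens_normal k b (x : E) : derivable b x.2 1 ->
  is_derive x (half_basis ord_max) (tens k b) (tens k (derive1 b) x).
Proof.
move=> db; rewrite /half_basis unlift_none.
apply: (@is_derive_line _ _ _ _ (fun r => profile k x.1 * b r) x.2).
  by move=> h; rewrite /tens /= scaler0 add0r /GRing.scale/= mulr1.
apply: is_derive_eq (is_deriveZ (profile k x.1) (derivableP db)) _.
by rewrite /tens derive1E.
Qed.

Lemma derive_tens_tangential k b j :
  'D_(half_basis (lift ord_max j)) (tens k b) = tens (incr k j) b.
Proof.
by apply/funext => x; have [_ ->] := is_derive_tens_tangential k b x j.
Qed.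

Lemma derive_tens_normal k b : Coo setT b ->
  'D_(half_basis ord_max) (tens k b) = tens k (derive1 b).
Proof.
move=> Cb; apply/funext => x; have db := Coo_derivable Cb (I : setT x.2).
by have [_ ->] := is_derive_tens_normal k db.
Qed.

Lemma tens_continuous k b (x : E) : {for x.2, continuous b} ->
  {for x, continuous (tens k b)}.
Proof.
move=> cb; apply: cvgM.
  apply: (@continuous_comp _ _ _ fst); first exact: cvg_fst.
  exact: profile_continuous.
by apply: (@continuous_comp _ _ _ snd); first exact: cvg_snd.
Qed.

Section smooth_tens.
Variables (D : set R) (oD : open D).
Let Omega : set E := [set x | D x.2].

Let oOmega : open Omega.
Proof. by apply: open_comp => // x _; exact: cvg_snd. Qed.

(** Equality is claimed on [Omega] only; as [Omega] is open, this survives differentiation. It thus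
    covers both the test functions, where [D] is the whole line, and the force, whose factor
    [weight] is smooth on the positive half-line. *)
Lemma iter_partial_tens k b (s : seq 'I_n.+1) : Coo D b ->
  exists k' m, forall x, Omega x ->
    iter_partial half_basis s (tens k b) x = tens k' (derive1n m b) x.
Proof.
move=> Cb; elim: s => [|i s [k' [m IH]]]; first by exists k, 0%N.
have dE x v : Omega x -> 'D_v (iter_partial half_basis s (tens k b)) x =
    'D_v (tens k' (derive1n m b)) x.
  move=> Ox; apply: near_eq_derive.
  by apply: filterS (open_nbhs_nbhs (conj oOmega Ox)) => y; exact: IH.
have [j ->|->] := unliftP ord_max i.
  exists (incr k' j), m => x Ox; rewrite /= dE//.
  by have [] := is_derive_tens_tangential k' (derive1n m b) x j.
exists k', m.+1 => x Ox; rewrite /= dE//.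
have db := Coo_derivable (Coo_derive1n m oD Cb) Ox.
by have [] := is_derive_tens_normal k' db.
Qed.

Lemma smooth_tens k b : Coo D b -> smooth_on half_basis Omega (tens k b).
Proof.
move=> Cb s x Ox; have [k' [m sE]] := iter_partial_tens k s Cb.
have near_sE : \forall y \near x,
    tens k' (derive1n m b) y = iter_partial half_basis s (tens k b) y.
  by apply: filterS (open_nbhs_nbhs (conj oOmega Ox)) => y /sE.
split.
  rewrite /prop_for /continuous_at sE//.
  apply: cvg_trans; first exact: near_eq_cvg near_sE.
  exact: tens_continuous (Coo_continuous (Coo_derive1n m oD Cb) Ox).
move=> i; apply: near_eq_derivable near_sE _.
have [j ->|->] := unliftP ord_max i.
  by have [] := is_derive_tens_tangential k' (derive1n m b) x j.
have db := Coo_derivable (Coo_derive1n m oD Cb) Ox.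
by have [] := is_derive_tens_normal k' db.
Qed.
End smooth_tens.

Lemma test_tens k b (c d : R) : 0 < c -> Coo setT b ->
  (forall s, ~ (c <= s <= d) -> b s = 0) ->
  test_function half_basis half_space (tens k b).
Proof.
move=> c0 Cb b0; split.
  by have := smooth_tens openT k Cb.
exists ([set x : V | forall j, 1 <= x ord0 j <= 4] `*` `[c, d]); split.
- by apply: compact_setX; [exact: compact_profile_support|exact: segment_compact].
- move=> [x s] [_] /=; rewrite in_itv/= => /andP[cs _].
  exact: lt_le_trans cs.
- move=> [x s]; rewrite not_andP /= => -[h|]; rewrite /tens/=.
    by rewrite profile_eq0// mul0r.
  by rewrite in_itv/= => /b0 ->; rewrite mulr0.
Qed.

End tensor_functions.

(** * Integrals over the half-space *)

Section half_space_integrals.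
Context {R : realType} {n : nat}.
Local Notation V := 'rV[R]_n.
Local Notation T := ('rV[R]_n * measurableTypeR R)%type.
Local Notation H := (half_space : set T).
Local Notation mu := (lebesgue_rV R n).
Local Notation lam := (@lebesgue_measure R).
Local Notation P := (@lebesgue_half R n).

Lemma measurable_half_space : measurable H.
Proof.
rewrite (_ : half_space = setT `*` [set t : R | 0 < t]).
  by apply: measurableX => //; exact: measurable_gt0.
by apply/seteqP; split => [[x t]|[x t] []].
Qed.

Lemma measurable_fun_section (v : T -> R) (t : R) : 0 < t ->
  measurable_fun H v -> measurable_fun setT (fun x : V => v (x, t)).
Proof.
move=> t0 mv.
have /(measurable_restrictT _ measurable_half_space) := mv.
move=> /measurableT_comp/(_ (pair2_measurable (t : measurableTypeR R))).
rewrite [X in measurable_fun _ X -> _](_ : _ = fun x : V => v (x, t))//.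
by apply/funext => x /=; rewrite patchE mem_set.
Qed.

Definition box (a b : R) : set V := [set x | forall j, a <= x ord0 j <= b].

Lemma box_itv (a b : R) :
  box a b = [set x | forall j, `[a, b]%classic (x ord0 j)].
Proof.
by apply/seteqP; split => x /= h j; have := h j; rewrite in_itv.
Qed.

Lemma measurable_box (a b : R) : measurable (box a b).
Proof.
rewrite (_ : box a b = \bigcap_(j in [set: 'I_n]) (@rV_coord R n j @^-1` `[a, b])).
  apply: fin_bigcap_measurable => // j _.
  by rewrite -[X in measurable X]setTI; apply: measurable_rV_coord.
by rewrite box_itv; apply/seteqP; split => x /= h j => [_|]; exact: h.
Qed.

Lemma lebesgue_rV_itv_box (a b : R) : a < b -> mu (box a b) = ((b - a) ^+ n)%:E.
Proof.
move=> ab; rewrite box_itv (@lebesgue_rV_box _ _ (fun=> `[a, b]%classic))//.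
under eq_bigr do rewrite lebesgue_measure_itv/= lte_fin ab -EFinD.
by rewrite prodEFin prodr_const card_ord.
Qed.

Lemma integral_half_prod (A : set V) (g : R -> R) :
  measurable A -> measurable_fun [set t : R | 0 < t] g ->
  (forall t, 0 < t -> 0 <= g t) ->
  (\int[P]_(x in H) (\1_A x.1 * g x.2)%:E =
   mu A * \int[lam]_(t in [set t | 0 < t]%R) (g t)%:E)%E.
Proof.
move=> mA mg g0.
pose F : T -> \bar R := (fun x : T => (\1_A x.1 * g x.2)%:E) \_ H.
have FE x t : F (x, t) = ((\1_A x)%:E * ((g \_ [set t | (0 < t)%R]) t)%:E)%E.
  rewrite /F !patchE -EFinM.
  have [t0|t0] := boolP (t \in [set t | 0 < t]).
    by rewrite mem_set//; move: t0; rewrite inE.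
  by rewrite memNset ?mulr0//; move: t0; rewrite notin_setE.
have mg' : measurable_fun setT (g \_ [set t | 0 < t]).
  exact/(measurable_restrictT _ measurable_gt0).
have g'0 t : 0 <= (g \_ [set t | 0 < t]) t.
  by rewrite patchE; case: ifPn => // /[!inE]; exact: g0.
have mF : measurable_fun setT F.
  rewrite (_ : F = fun z => ((\1_A z.1) * (g \_ [set t | 0 < t]) z.2)%:E).
    apply/measurable_EFinP; apply: measurable_funM.
      by apply: measurableT_comp => //; exact: measurable_indic.
    exact: (measurableT_comp mg').
  by apply/funext => -[x t]; rewrite FE.
rewrite integral_mkcond -/F.
(* [P] is convertible to the product measure; the restatement exposes it to Tonelli's theorem. *)
transitivity (\int[(mu \x lam)%E]_z F z)%E; first by [].
rewrite fubini_tonelli2//; last first.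
  by move=> [x t]; rewrite FE -EFinM lee_fin mulr_ge0.
rewrite [in RHS]integral_mkcond -ge0_integralZl//.
- apply: eq_integral => t _; rewrite /fubini_G.
  under eq_integral do rewrite FE.
  rewrite ge0_integralZr//; last 2 first.
  + by apply/measurable_EFinP; exact: measurable_indic.
  + by rewrite lee_fin.
  by rewrite integral_indic// setIT restrict_EFin.
- by rewrite restrict_EFin; exact/measurable_EFinP.
- by move=> t _; rewrite restrict_EFin lee_fin.
Qed.

(** Tonelli for the indicator of the exceptional null set: almost all its horizontal slices are
    null. This carries [v = u] over to almost every slice. *)
Lemma ae_half_section (Q : T -> Prop) :
  {ae P, forall z, H z -> Q z} ->
  {ae lam, forall t : R, 0 < t -> {ae mu, forall x, Q (x, t)}}.
Proof.
move=> [N [mN N0 QN]].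
have : ae_eq lam setT (mu \o ysection N) (cst 0%E).
  apply/ae_eq_integral_abs => //; first exact: measurable_fun_ysection.
  under eq_integral do rewrite gee0_abs//.
  transitivity (\int[lam]_y fubini_G mu (EFin \o \1_N) y)%E.
    by rewrite indic_fubini_tonelli_GE//; exact: mN.
  rewrite -(indic_fubini_tonelli mu lam (mN : measurable (N : set T))).
  rewrite -(indic_fubini_tonelli1 mu lam (mN : measurable (N : set T))).
  by rewrite integral_indic// setIT.
apply: filterS => t /(_ I) Nt t0.
exists (ysection N t); split=> //; first exact: measurable_ysection.
move=> x /= nQ; rewrite /ysection/= inE; apply: QN => /=.
by move/(_ t0).
Qed.

End half_space_integrals.

(** * Integrability against the first moment in the normal variable *)

Section weighted_moments.
Context {R : realType} {n : nat}.
Local Notation V := 'rV[R]_n.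
Local Notation T := ('rV[R]_n * measurableTypeR R)%type.
Local Notation H := (half_space : set T).
Local Notation mu := (lebesgue_rV R n).
Local Notation lam := (@lebesgue_measure R).
Local Notation P := (@lebesgue_half R n).
Local Notation mH := (@measurable_half_space R n).

(* Young's inequality for [(a * s `^ (beta / p)) * s `^ (1 - beta / p)] *)
Lemma weighted_young (p beta a s : R) : 1 < p -> 0 <= a -> 0 < s ->
  a * s <= a `^ p * s `^ beta + s `^ ((p - beta) / (p - 1)).
Proof.
move=> p1 a0 s0; have p0 : 0 < p by lra.
have p10 : 0 < p - 1 by rewrite subr_gt0.
have q0 : 0 < p / (p - 1) by rewrite divr_gt0.
have pq : p^-1 + (p / (p - 1))^-1 = 1.
  by field; rewrite !lt0r_neq0.
have := @conjugate_powR R (a * s `^ (beta / p)) (s `^ (1 - beta / p)) _ _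
  (mulr_ge0 a0 (powR_ge0 _ _)) (powR_ge0 _ _) p0 q0 pq.
rewrite -mulrA -powRD; last by rewrite (lt0r_neq0 s0) implybT.
rewrite [beta / p + _]addrC subrK (powRr1 (ltW s0)) powRM ?powR_ge0// -!powRrM.
rewrite divfK ?lt0r_neq0//.
have -> : (1 - beta / p) * (p / (p - 1)) = (p - beta) / (p - 1).
  by field; rewrite !lt0r_neq0.
move=> /le_trans; apply; apply: lerD.
  by rewrite ler_pdivrMr// ler_peMr ?mulr_ge0 ?powR_ge0// ltW.
rewrite ler_pdivrMr// ler_peMr ?powR_ge0//.
by rewrite ler_pdivlMr// mul1r gerBl.
Qed.

(** The common majorant: since [|cut e b t| <= t], it dominates [tens k (cut e b)], for
    [2 * b <= 1], up to a constant free of [e]. *)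
Definition first_moment (x : T) : R :=
  x.2 * (\1_(box 1 4) x.1 * \1_`]0, 1] x.2).

Lemma first_moment_ge0 x : H x -> 0 <= first_moment x.
Proof. by move=> /ltW x0; rewrite !mulr_ge0. Qed.

Lemma measurable_first_moment : measurable_fun setT first_moment.
Proof.
apply: measurable_funM; first exact: measurable_snd.
apply: measurable_funM; apply: measurableT_comp => //.
by apply: measurable_indic; exact: measurable_box.
Qed.

(* The only place where [beta < 2 * p - 1] is needed for [u], [F] and [f]: it
   makes [t `^ ((p - beta) / (p - 1))] integrable at 0. *)
Lemma integrable_moment (p beta : R) (w : T -> R) : 1 < p -> beta < 2 * p - 1 ->
  weighted_Lp p beta w ->
  P.-integrable H (fun x => (`|w x| * first_moment x)%:E).
Proof.
move=> p1 b2 [mw wp]; pose g := (p - beta) / (p - 1).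
have g1 : -1 < g by rewrite ltr_pdivlMr; lra.
have mw' : measurable_fun H (w : T -> R) by exact: mw.
have i1 : P.-integrable H (fun x : T => (`|w x| `^ p * x.2 `^ beta)%:E).
  apply/integrableP; split.
    apply/measurable_EFinP; apply: measurable_funM.
      apply: (@measurableT_comp _ _ _ _ _ _ (fun y : R => y `^ p)).
        exact: measurable_powR.
      exact: measurableT_comp.
    apply: measurable_funTS; apply: (@measurableT_comp _ _ _ _ _ _ (fun y : R => y `^ beta)).
      exact: measurable_powR.
    exact: measurable_snd.
  under eq_integral do rewrite gee0_abs ?lee_fin ?mulr_ge0 ?powR_ge0//.
  exact: wp.
pose h := (fun t : R => t `^ g) \_ `]0, 1].
have mh : measurable_fun setT h.
  apply/(measurable_restrictT _ _).1 => //; apply: measurable_funTS.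
  exact: measurable_powR.
have h0 t : 0 <= h t by rewrite /h patchE; case: ifPn => // _; exact: powR_ge0.
have i2 : P.-integrable H (fun x : T => (\1_(box 1 4) x.1 * h x.2)%:E).
  apply/integrableP; split.
    apply/measurable_EFinP; apply: measurable_funTS; apply: measurable_funM.
      apply: measurableT_comp => //.
      by apply: measurable_indic; exact: measurable_box.
    exact: (measurableT_comp mh).
  under eq_integral do rewrite gee0_abs ?lee_fin ?mulr_ge0//.
  rewrite (integral_half_prod (measurable_box 1 4))//; last exact: measurable_funTS.
  rewrite lebesgue_rV_itv_box ?ltr1n// lte_mul_pinfty//.
  apply: le_lt_trans (integral_powR_unit g1).
  rewrite le_eqVlt; apply/orP; left; apply/eqP.
  transitivity (\int[lam]_(t in [set t : R | (0 < t)%R])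
      ((fun t : R => (t `^ g)%:E) \_ [set` `]0%R, 1%R]]) t)%E.
    by apply: eq_integral => t _; rewrite /h !patchE; case: ifP.
  rewrite -integral_mkcondr; congr (integral _ _ _).
  apply/seteqP; split => t /=; first by case.
  by rewrite in_itv/= => /andP[-> ->].
apply: (le_integrable mH _ _ (integrableD mH i1 i2)).
  apply/measurable_EFinP; apply: measurable_funM; first exact: measurableT_comp.
  by apply: measurable_funTS; exact: measurable_first_moment.
move=> x x0; rewrite /= lee_fin ger0_norm; last first.
  by apply: mulr_ge0 => //; exact: first_moment_ge0.
rewrite [leRHS]ger0_norm; last by rewrite addr_ge0 ?mulr_ge0 ?powR_ge0.
rewrite /first_moment /h patchE !indicE.
have [x1|x1] := boolP (x.1 \in _); last first.
  by rewrite !mul0r !mulr0 addr0 mulr_ge0 ?powR_ge0.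
have [x2|x2] := boolP (x.2 \in _); last first.
  by rewrite !mulr0 addr0 mulr_ge0 ?powR_ge0.
by rewrite !mulr1 mul1r weighted_young.
Qed.

Section moment.
Variables (p beta : R) (w : T -> R).
Hypotheses (p1 : 1 < p) (b2 : beta < 2 * p - 1) (wp : weighted_Lp p beta w).

Lemma integrable_first_moment (th : T -> R) (C : R) : measurable_fun setT th ->
  (forall x, H x -> `|th x| <= C * first_moment x) ->
  P.-integrable H (fun x => (w x * th x)%:E).
Proof.
move=> mth thC; have [mw _] := wp.
apply: (le_integrable mH _ _ (integrableZl mH C (integrable_moment p1 b2 wp))).
  apply/measurable_EFinP; apply: measurable_funM; first exact: mw.
  exact: measurable_funTS.
move=> x x0; rewrite /= lee_fin normrM; apply: le_trans (ler_norm _).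
by rewrite mulrCA ler_wpM2l// thC.
Qed.

Lemma Rintegral_moment_le (th : T -> R) (C : R) : measurable_fun setT th ->
  (forall x, H x -> `|th x| <= C * first_moment x) ->
  `|\int[P]_(x in H) (w x * th x)| <=
    C * \int[P]_(x in H) (`|w x| * first_moment x).
Proof.
move=> mth thC; have iw := integrable_moment p1 b2 wp.
have ith := integrable_first_moment mth thC.
rewrite (le_trans (le_normr_Rintegral mH ith))//.
rewrite -(RintegralZl _ mH iw). apply: (le_Rintegral mH).
- exact: (integrable_abse ith).
- exact: (integrableZl mH C iw).
- by move=> x x0; rewrite normrM mulrCA ler_wpM2l// thC.
Qed.

End moment.

(** Meant for the weak gradient in the definition of a weak solution, which is only locally
    integrable: a support at distance [c > 0] from the boundary replaces the moment bound. *)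
Lemma locally_integrable_bounded (w th : T -> R) (c d M : R) : 0 < c ->
  locally_integrable_half w -> measurable_fun setT th ->
  (forall x, `|th x| <= M) ->
  (forall x, ~ (box 1 4 `*` `[c, d]) x -> th x = 0) ->
  P.-integrable H (fun x => (w x * th x)%:E).
Proof.
move=> c0 lw mth thM th0.
pose K : set T := box 1 4 `*` `[c, d].
have mK : measurable K by apply: measurableX => //; exact: measurable_box.
have iw : P.-integrable K (EFin \o w).
  apply: lw.
    by apply: compact_setX; [exact: compact_profile_support|exact: segment_compact].
  by move=> [x t] [_] /=; rewrite in_itv/= => /andP[+ _]; exact: lt_le_trans.
apply: (@integrableS _ _ _ _ setT _ _ measurableT mH) => //.
apply: (eq_integrable measurableT ((fun x => (w x * th x)%:E) \_ K)).
  move=> x _; rewrite patchE; case: ifPn => // /negP xK.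
  by rewrite th0 ?mulr0// => Kx; apply: xK; rewrite inE.
apply/(integrable_mkcond _ mK).
apply: (le_integrable mK _ _ (integrableZl mK M iw)).
  apply/measurable_EFinP; apply: measurable_funM; last exact: measurable_funTS.
  by have /integrableP[/measurable_EFinP] := iw.
move=> x _; rewrite /= lee_fin !normrM mulrC ler_wpM2r//.
by rewrite (le_trans (thM x))// ler_norm.
Qed.

End weighted_moments.

(** * Averages of the solution over horizontal slices *)

Section averages.
Context {R : realType} {n : nat}.
Local Notation V := 'rV[R]_n.
Local Notation T := ('rV[R]_n * measurableTypeR R)%type.
Local Notation H := (half_space : set T).
Local Notation mu := (lebesgue_rV R n).
Local Notation lam := (@lebesgue_measure R).
Local Notation P := (@lebesgue_half R n).
Local Notation mH := (@measurable_half_space R n).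
Local Notation eta := (@profile R n (fun=> 0%N)).

(** Convergence against the single test function [eta] already bounds the averages near 0. The limit
    concerns [v] and the equation concerns [u], hence a bound for almost every [t]. *)
Lemma average_bounded_near0 (p beta : R) (u v : T -> R) :
  weighted_Lp p beta u -> Lp_continuous_version p u v ->
  has_distribution_limit_at0 (slice v) ->
  exists M d : R, [/\ 0 <= M, 0 < d &
    {ae lam, forall t : R, 0 < t -> t < d ->
      `|\int[mu]_x (u (x, t) * eta x)| <= M}].
Proof.
move=> [mu_ _] [uv vL _] [S _ /(_ _ (test_profile (fun=> 0%N))) cv].
have : \forall t \near 0^'+, `|\int[mu]_x (slice v t x * eta x)| <= `|S eta| + 1.
  move/cvgrPdist_le : cv => /(_ 1 ltr01); apply: filterS => t h.
  rewrite -lerBlDl (le_trans _ h)// distrC.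
  exact: lerB_dist.
rewrite near_withinE => -[d /= d0 hd].
exists (`|S eta| + 1), d; split=> //.
have := ae_half_section uv.
apply: (@filterS _ _ (ae_filter_ringOfSetsType lam)) => t /[swap] t0.
move=> /(_ t0) uvt td.
have -> : \int[mu]_x (u (x, t) * eta x) = \int[mu]_x (slice v t x * eta x).
  rewrite /Rintegral; congr fine; apply: ae_eq_integral => //.
  - apply/measurable_EFinP; apply: measurable_funM; last exact: measurable_profile.
    exact: measurable_fun_section.
  - apply/measurable_EFinP; apply: measurable_funM; last exact: measurable_profile.
    have /andP[] := vL t t0; rewrite inE => mv _; exact: mv.
  - by apply: filterS uvt => x vu _; rewrite /slice vu.
by apply: hd => //=; rewrite sub0r normrN gtr0_norm.
Qed.

(** By Fubini the left-hand side is the integral of [U rho], with [U(t)] the average of [u(., t)]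
    against [eta]. The constant [A] secures integrability and is absent from the bound, so [rho] may
    be as large as [1 / e]. *)
Lemma normal_average_le (p beta : R) (u : T -> R) (M dl c d A : R) (rho : R -> R) :
  1 < p -> beta < 2 * p - 1 -> weighted_Lp p beta u ->
  0 < c -> d <= 1 -> d < dl -> 0 <= M ->
  {ae lam, forall t : R, 0 < t -> t < dl ->
    `|\int[mu]_x (u (x, t) * eta x)| <= M} ->
  measurable_fun setT rho -> (forall t, `|rho t| <= A * \1_(`[c, d]) t) ->
  (`|\int[P]_(x in H) (u x * (eta x.1 * rho x.2))|%:E <=
    \int[lam]_t (M * `|rho t|)%:E)%E.
Proof.
move=> p1 b2 Lu c0 d1 ddl M0 haeM mrho rhoA.
have meta : measurable_fun setT (fun x : T => eta x.1).
  by apply: measurableT_comp => //; exact: measurable_profile.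
(* On [[c, d]] one has [1 <= t / c], so a bounded factor supported there is dominated by the first
   moment. *)
have ceta (x : T) (r : R -> R) (B : R) : 0 <= B ->
    (forall t, `|r t| <= B * \1_(`[c, d]) t) ->
    H x -> `|eta x.1 * r x.2| <= (B / c) * first_moment x.
  move=> B0 rB x0; rewrite normrM /first_moment.
  have [xb|xb] := pselect (box 1 4 x.1); last first.
    by rewrite profile_eq0// normr0 mul0r mulr_ge0 ?divr_ge0 ?(ltW c0)// first_moment_ge0.
  rewrite ger0_norm ?profile0_ge0//.
  rewrite (le_trans (ler_piMl _ (profile0_le1 _)))//.
  rewrite (le_trans (rB _))// [in leRHS]indicE mem_set// mul1r.
  rewrite -mulrA ler_wpM2l// !indicE !mem_setE !in_itv/=.
  have [/andP[cx xd]|_] := boolP (_ && _); last first.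
    by rewrite !mulr_ge0// ?invr_ge0 ltW.
  rewrite (lt_le_trans c0 cx) (le_trans xd d1) mulr1.
  by rewrite mulrC ler_pdivlMr// mul1r.
(* With the indicator in place of [rho], Fubini yields the integrability of the slice [u(., t) eta]
   itself for almost every [t] in [[c, d]], with no division by [rho t]. *)
pose h (x : T) := u x * (eta x.1 * \1_(`[c, d]) x.2).
have ih : P.-integrable H (EFin \o h).
  apply: (integrable_first_moment p1 b2 Lu (C := 1 / c)).
    by apply: measurable_funM => //; exact: measurableT_comp.
  move=> x x0; apply: ceta => // t; by rewrite mul1r ger0_norm.
pose f (x : T) := u x * (eta x.1 * rho x.2).
have if_ : P.-integrable H (EFin \o f).
  have rhoA' t : `|rho t| <= `|A| * \1_(`[c, d]) t.
    by rewrite (le_trans (rhoA t))// ler_wpM2r// ler_norm.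
  apply: (integrable_first_moment p1 b2 Lu (C := `|A| / c)).
    by apply: measurable_funM => //; exact: measurableT_comp.
  by move=> x x0; apply: ceta.
have /(integrable_mkcond _ mH) ihT := ih.
have /(integrable_mkcond _ mH) ifT := if_.
rewrite (EFin_normr_Rintegral mH if_) integral_mkcond.
have -> : (\int[P]_x ((EFin \o f) \_ H) x =
    \int[lam]_y fubini_G mu ((EFin \o f) \_ H) y)%E.
  by rewrite (integral21_prod_meas1 ifT).
have mG := measurable_fubini_G ifT.
apply: (le_trans (le_abse_integral _ measurableT mG)).
apply: ae_ge0_le_integral => //.
- exact: measurableT_comp.
- by move=> t _; rewrite lee_fin mulr_ge0.
- by apply/measurable_EFinP; apply: measurable_funM => //; exact: measurableT_comp.
have := ae_integrable2 ihT.
apply: (@filterS2 _ _ (ae_filter_ringOfSetsType lam)) haeM => t hM iht _.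
have [t0|t0] := ltP 0 t; last first.
  rewrite /fubini_G integral0_eq ?abse0 ?lee_fin ?mulr_ge0//.
  move=> x _; rewrite patchE memNset// /half_space/= => t0'.
  by move: t0; rewrite leNgt t0'.
have fE x : ((EFin \o f) \_ H) (x, t) = (f (x, t))%:E.
  by rewrite patchE mem_set.
have hE x : ((EFin \o h) \_ H) (x, t) = (h (x, t))%:E.
  by rewrite patchE mem_set.
have [tcd|tcd] := boolP (t \in `[c, d]); last first.
  have rt0 : rho t = 0.
    apply/normr0_eq0/le_anti; rewrite normr_ge0 andbT (le_trans (rhoA t))//.
    by rewrite indicE mem_setE (negbTE tcd) mulr0.
  rewrite /fubini_G integral0_eq ?abse0 ?lee_fin ?mulr_ge0//.
  by move=> x _; rewrite fE /f/= rt0 !mulr0.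
have td : t < dl by move: tcd; rewrite in_itv/= => /andP[_ /le_lt_trans]; exact.
have iu : mu.-integrable setT (fun x => (u (x, t) * eta x)%:E).
  apply: (eq_integrable measurableT _ _ _ iht) => x _ /=.
  by rewrite hE /h/= indicE mem_setE tcd mulr1.
have -> : fubini_G mu ((EFin \o f) \_ H) t =
    ((\int[mu]_x (u (x, t) * eta x)) * rho t)%:E.
  rewrite /fubini_G; under eq_integral do rewrite fE.
  rewrite -RintegralZr// /Rintegral fineK; last first.
    apply: integrable_fin_num => //.
    have := integrableZl measurableT (rho t) iu.
    by apply: eq_integrable => // x _ /=; rewrite -EFinM mulrC.
  by apply: eq_integral => x _; rewrite /f/= mulrA.
by rewrite /= lee_fin normrM ler_wpM2r// hM.
Qed.

End averages.

(** * The counterexample *)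

Lemma Rintegral_sum d (T : measurableType d) (R : realType)
    (mu : {measure set T -> \bar R}) (D : set T) (I : Type) (s : seq I)
    (h : I -> T -> R) : measurable D ->
  (forall i, mu.-integrable D (EFin \o h i)) ->
  mu.-integrable D (fun x => (\sum_(i <- s) h i x)%:E) /\
  \int[mu]_(x in D) (\sum_(i <- s) h i x) = \sum_(i <- s) \int[mu]_(x in D) h i x.
Proof.
move=> mD ih; elim: s => [|i s [IHi IHe]].
  split.
    apply: (eq_integrable mD (cst 0%E)); last exact: integrable0.
    by move=> x _; rewrite big_nil.
  rewrite big_nil (@eq_Rintegral _ _ _ mu D (cst 0)) ?Rintegral_cst ?mul0r//.
  by move=> x _; rewrite big_nil.
split.
  apply: (eq_integrable mD ((EFin \o h i) \+ (fun x => (\sum_(i <- s) h i x)%:E))%E).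
    by move=> x _; rewrite big_cons EFinD.
  exact: integrableD.
rewrite big_cons -IHe -RintegralD//.
by apply: eq_Rintegral => x _; rewrite big_cons.
Qed.

Section counterexample.
Context {R : realType} {n : nat}.
Local Notation V := 'rV[R]_n.
Local Notation T := ('rV[R]_n * measurableTypeR R)%type.
Local Notation H := (half_space : set T).
Local Notation mu := (lebesgue_rV R n).
Local Notation lam := (@lebesgue_measure R).
Local Notation P := (@lebesgue_half R n).
Local Notation mH := (@measurable_half_space R n).
Local Notation k0 := (fun=> 0%N : nat).
Local Notation eta := (@profile R n k0).

Definition singular_force : 'rV[R]_n * R -> R := tens k0 weight.

Lemma smooth_singular_force : smooth_on half_basis half_space singular_force.
Proof. exact: (@smooth_tens R n _ (@open_gt R 0) k0 weight Coo_weight). Qed.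

Lemma measurable_tens k (r : R -> R) : measurable_fun [set t : R | 0 < t] r ->
  measurable_fun H (tens k r).
Proof.
move=> mr; apply: measurable_funM.
  apply: measurable_funTS; apply: measurableT_comp => //.
  exact: measurable_profile.
apply: (measurable_comp measurable_gt0 _ mr).
  by move=> _ [x x0 <-].
by apply: measurable_funTS; exact: measurable_snd.
Qed.

Lemma measurable_tensT k (r : R -> R) : measurable_fun setT r ->
  measurable_fun setT (tens k r : T -> R).
Proof.
move=> mr; apply: measurable_funM; apply: measurableT_comp => //.
exact: measurable_profile.
Qed.

Lemma measurable_weight : measurable_fun [set t : R | 0 < t] weight.
Proof.
apply: measurable_fun_gt0 => t t0; exact: Coo_continuous Coo_weight _.
Qed.

Lemma weighted_Lp_singular_force (p beta : R) : 1 < p ->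
  p - 1 <= beta < 2 * p - 1 -> weighted_Lp p beta singular_force.
Proof.
move=> p1 hb; have p0 : 0 < p by lra.
split; first exact: measurable_tens measurable_weight.
have mg : measurable_fun [set t : R | 0 < t] (fun t => weight t `^ p * t `^ beta).
  apply: measurable_funM.
    apply: (@measurableT_comp _ _ _ _ _ _ (fun y : R => y `^ p)).
      exact: measurable_powR.
    exact: measurable_weight.
  apply: measurable_funTS; exact: measurable_powR.
apply: (@le_lt_trans _ _ (\int[P]_(x in H)
    (\1_(box 1 4) x.1 * (weight x.2 `^ p * x.2 `^ beta))%:E)%E).
  apply: ge0_le_integral; first exact: mH.
  - by move=> x _; rewrite lee_fin mulr_ge0 ?powR_ge0.
  - apply/measurable_EFinP; apply: measurable_funM.
      apply: (@measurableT_comp _ _ _ _ _ _ (fun y : R => y `^ p)).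
        exact: measurable_powR.
      apply: measurableT_comp => //; exact: measurable_tens measurable_weight.
    apply: measurable_funTS.
    apply: (@measurableT_comp _ _ _ _ _ _ (fun y : R => y `^ beta)).
      exact: measurable_powR.
    exact: measurable_snd.
  - apply/measurable_EFinP; apply: measurable_funM.
      apply: measurable_funTS; apply: measurableT_comp => //.
      by apply: measurable_indic; exact: measurable_box.
    apply: (measurable_comp measurable_gt0 _ mg); first by move=> _ [x x0 <-].
    by apply: measurable_funTS; exact: measurable_snd.
  - move=> x x0; rewrite lee_fin mulrA ler_wpM2r ?powR_ge0//.
    have w0 := weight_gt0 x0.
    rewrite /singular_force /tens normrM (gtr0_norm w0) (powRM _ (normr_ge0 _) (ltW w0)).
    rewrite ler_wpM2r ?powR_ge0// ger0_norm ?profile0_ge0// indicE.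
    have [xb|xb] := boolP (x.1 \in box 1 4); last first.
      rewrite profile_eq0 ?powR0 ?lt0r_neq0//.
      by move=> xb'; move/negP: xb; apply; rewrite inE.
    apply: (@le_trans _ _ (1 `^ p)); last by rewrite powR1.
    apply: ge0_ler_powR; rewrite ?nnegrE ?profile0_ge0 ?profile0_le1//.
    exact: ltW.
rewrite (integral_half_prod (measurable_box 1 4) mg); last first.
  by move=> t _; rewrite mulr_ge0 ?powR_ge0.
by rewrite lebesgue_rV_itv_box ?ltr1n// lte_mul_pinfty// integral_weight_powR.
Qed.

Lemma tens_le_moment k (r : R -> R) (C B : R) : 0 <= B ->
  (forall x, `|profile k x| <= C) ->
  (forall t, 0 < t -> `|r t| <= B * (t * \1_(`]0, 1]) t)) ->
  forall x, H x -> `|tens k r x| <= (C * B) * first_moment x.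
Proof.
move=> B0 kC rB x x0; rewrite /tens normrM /first_moment.
have C0 : 0 <= C by apply: le_trans (kC x.1).
have [xb|xb] := pselect (box 1 4 x.1); last first.
  by rewrite profile_eq0// normr0 mul0r !mulr_ge0// ltW.
rewrite [in leRHS]indicE mem_set// mul1r -mulrA.
by apply: ler_pM => //; apply: rB.
Qed.

Section test_functions.
Variables (b : R -> R) (c d : R).
Hypotheses (c0 : 0 < c) (d1 : d <= 1) (Cb : Coo setT b).
Hypothesis b0 : forall s, ~ (c <= s <= d) -> b s = 0.

(** The orders are left free so that the class contains the derivatives of its members, against
    which the weak gradient is tested too. *)
Definition admissible (th : 'rV[R]_n * R -> R) :=
  exists k m, th = tens k (derive1n m b).

Lemma admissible_derive th i : admissible th ->
  admissible ('D_(half_basis i) th).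
Proof.
move=> [k [m ->]]; have [j ->|->] := unliftP ord_max i.
  by exists (incr k j), m; exact: derive_tens_tangential.
by exists k, m.+1; rewrite derive_tens_normal//; exact: Coo_derive1n openT Cb.
Qed.

Lemma admissible_test th : admissible th ->
  test_function half_basis half_space th.
Proof.
move=> [k [m ->]]; apply: (@test_tens _ _ _ _ c d) => //.
  exact: Coo_derive1n openT Cb.
by move=> s; exact: derive1n_support b0.
Qed.

Let measurable_admissible k m : measurable_fun setT (tens k (derive1n m b) : T -> R).
Proof.
apply: measurable_tensT; apply: continuous_measurable_fun.
exact: Coo_continuousT (Coo_derive1n m openT Cb).
Qed.

Lemma admissible_integrable_loc th w : admissible th ->
  locally_integrable_half w -> P.-integrable H (fun x => (w x * th x)%:E).
Proof.
move=> [k [m ->]] lw.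
have [B B0 bB] := derive1n_bounded m Cb b0.
have [C C0 kC] := @profile_bounded R n k.
apply: (@locally_integrable_bounded _ _ _ _ c d (C * B)) => //.
  by move=> x; rewrite normrM ler_pM.
move=> x; rewrite not_andP => -[xb|xb]; rewrite /tens.
  by rewrite profile_eq0// mul0r.
by rewrite (derive1n_support _ b0) ?mulr0//; move: xb; rewrite /= in_itv.
Qed.

Lemma admissible_integrable_Lp th w p beta : 1 < p -> beta < 2 * p - 1 ->
  admissible th -> weighted_Lp p beta w ->
  P.-integrable H (fun x => (w x * th x)%:E).
Proof.
move=> p1 b2 [k [m ->]] Lw.
have [B B0 bB] := derive1n_bounded m Cb b0.
have [C C0 kC] := @profile_bounded R n k.
apply: (integrable_first_moment p1 b2 Lw (C := C * (B / c))) => //.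
apply: tens_le_moment => //; first by rewrite divr_ge0// ltW.
move=> t t0; have [tcd|tcd] := pselect (is_true (c <= t <= d)); last first.
  by rewrite (derive1n_support _ b0)// normr0 !mulr_ge0// ?invr_ge0 ltW.
have /andP[ct td] := tcd.
rewrite indicE mem_setE in_itv/= t0 (le_trans td d1) mulr1 (le_trans (bB t))//.
by rewrite -mulrA ler_peMr// mulrC ler_pdivlMr// mul1r.
Qed.

(* The derivatives of [u] are integrated by parts once more, so that no bound
   on the gradient appearing in the weak formulation is required. *)
Lemma weak_solution_identity (p beta : R) u F Fd f k : 1 < p -> beta < 2 * p - 1 ->
  weighted_Lp p beta u -> (forall j, weighted_Lp p beta (F j)) ->
  weighted_Lp p beta Fd -> weighted_Lp p beta f -> weak_solution u F Fd f ->
  \int[P]_(x in H) (Fd x * tens k (derive1 b) x) =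
  - \sum_(i < n.+1) \int[P]_(x in H)
      (u x * 'D_(half_basis i) ('D_(half_basis i) (tens k b)) x) +
  \int[P]_(x in H) (u x * tens k b x) -
  \sum_(j < n) \int[P]_(x in H) (F j x * tens (incr k j) b x) -
  \int[P]_(x in H) (f x * tens k b x).
Proof.
move=> p1 b2 Lu LF LFd Lf [Du [[lu wDu] ws]].
have aphi : admissible (tens k b) by exists k, 0%N.
have aD i := admissible_derive i aphi.
have intL := fun th w => @admissible_integrable_Lp th w p beta p1 b2.
have := ws _ (admissible_test aphi).
have [iS eS] := @Rintegral_sum _ _ _ P H _ (index_enum 'I_n.+1)
  (fun i x => Du i x * 'D_(half_basis i) (tens k b) x) mH
  (fun i => admissible_integrable_loc (aD i) (wDu i).1).
have [iF eF] := @Rintegral_sum _ _ _ P H _ (index_enum 'I_n)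
  (fun j x => F j x * 'D_(half_basis (lift ord_max j)) (tens k b) x) mH
  (fun j => intL _ _ (aD _) (LF j)).
rewrite (RintegralD mH iS (intL _ _ aphi Lu)) eS.
rewrite (RintegralD mH _ (intL _ _ aphi Lf)); last first.
  exact: (integrableD mH iF (intL _ _ (aD ord_max) LFd)).
rewrite (RintegralD mH iF (intL _ _ (aD ord_max) LFd)) eF.
have -> : \int[P]_(x in H) (Fd x * 'D_(half_basis ord_max) (tens k b) x) =
    \int[P]_(x in H) (Fd x * tens k (derive1 b) x).
  by apply: eq_Rintegral => x _; rewrite -derive_tens_normal.
have -> : \sum_(j < n) \int[P]_(x in H)
      (F j x * 'D_(half_basis (lift ord_max j)) (tens k b) x) =
    \sum_(j < n) \int[P]_(x in H) (F j x * tens (incr k j) b x).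
  apply: eq_bigr => j _; apply: eq_Rintegral => x _.
  by rewrite -derive_tens_tangential.
have -> : \sum_(i < n.+1) \int[P]_(x in H)
    (Du i x * 'D_(half_basis i) (tens k b) x) =
  - \sum_(i < n.+1) \int[P]_(x in H)
      (u x * 'D_(half_basis i) ('D_(half_basis i) (tens k b)) x).
  rewrite -sumrN; apply: eq_bigr => i _.
  by rewrite (wDu i).2 ?opprK//; exact: admissible_test.
by move=> ->; ring.
Qed.

End test_functions.
End counterexample.

(** * Estimates uniform in the cut-off, and the contradiction *)

Section contradiction.
Context {R : realType} {n : nat}.
Local Notation V := 'rV[R]_n.
Local Notation T := ('rV[R]_n * measurableTypeR R)%type.
Local Notation H := (half_space : set T).
Local Notation mu := (lebesgue_rV R n).
Local Notation lam := (@lebesgue_measure R).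
Local Notation P := (@lebesgue_half R n).
Local Notation mH := (@measurable_half_space R n).
Local Notation k0 := (fun=> 0%N : nat).
Local Notation eta := (@profile R n k0).
Local Notation force := (@singular_force R n).

Lemma integral_dyadic_indic (D : set R) (A c : R) : measurable D -> 0 <= A ->
  0 < c -> `[c, 2 * c]%classic `<=` D ->
  (\int[lam]_(t in D) (A / c * \1_(`[c, 2 * c]) t)%:E = A%:E)%E.
Proof.
move=> mD A0 c0 cD; under eq_integral do rewrite EFinM.
rewrite ge0_integralZl//; last 2 first.
- by apply/measurable_EFinP; exact: measurable_indic.
- by rewrite lee_fin divr_ge0// ltW.
rewrite integral_indic// setIidl//.
transitivity ((A / c)%:E * c%:E)%E.
  congr (_ * _)%E; rewrite [LHS]lebesgue_measure_itv/= lte_fin.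
  have c2 : c < 2 * c by lra.
  by rewrite c2 -EFinD; congr EFin; ring.
by rewrite -EFinM divfK// lt0r_neq0.
Qed.

(** Its total mass does not depend on [e] and [b]. With [A = C] it majorizes [cut'']; with
    [A = C + 1] it absorbs the loss of [weight * cut'] on the transition intervals. *)
Definition dyadic_bump (A e b t : R) : R :=
  A / e * \1_(`[e, 2 * e]) t + A / b * \1_(`[b, 2 * b]) t.

Lemma dyadic_bump_ge0 A e b t : 0 <= A -> 0 < e -> 0 < b ->
  0 <= dyadic_bump A e b t.
Proof. by move=> A0 e0 b0; rewrite addr_ge0// mulr_ge0// divr_ge0// ltW. Qed.

Lemma measurable_dyadic_bump A e b : measurable_fun setT (dyadic_bump A e b).
Proof.
by apply: measurable_funD; apply: measurable_funM => //; exact: measurable_indic.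
Qed.

Lemma integral_dyadic_bump (D : set R) (A e b : R) : measurable D -> 0 <= A ->
  0 < e -> 0 < b -> [set t | 0 < t] `<=` D ->
  (\int[lam]_(t in D) (dyadic_bump A e b t)%:E = (2 * A)%:E)%E.
Proof.
move=> mD A0 e0 b0 D0; rewrite /dyadic_bump.
have sub c : 0 < c -> `[c, 2 * c]%classic `<=` D.
  move=> c0 t /=; rewrite in_itv/= => /andP[ct _]; apply: D0.
  exact: lt_le_trans ct.
under eq_integral do rewrite EFinD.
rewrite ge0_integralD//; last 4 first.
- by move=> t _; rewrite lee_fin mulr_ge0// divr_ge0// ltW.
- by apply/measurable_EFinP; exact: measurable_funM.
- by move=> t _; rewrite lee_fin mulr_ge0// divr_ge0// ltW.
- by apply/measurable_EFinP; exact: measurable_funM.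
rewrite !integral_dyadic_indic//; [|exact: sub|exact: sub].
by rewrite -EFinD mulr_natl.
Qed.

(** [eta ^ 2] lies between the indicators of [box 2 3], of measure 1, and [box 1 4], of measure
    [3 ^+ n]. The divergent part is collected on the former; the error, a dyadic bump of mass
    [2 * (C + 1)], is integrated over the latter. *)
Lemma singular_force_lower (e b C : R) : 0 < e -> 2 * e < b -> 2 * b <= 1 ->
  0 <= C ->
  (forall r, 1 <= r <= 2 ->
    `|derive1 ramp r| <= C /\ `|derive1 (derive1 ramp) r| <= C) ->
  P.-integrable H (fun x => (force x * tens k0 (derive1 (cut e b)) x)%:E) ->
  (ln (1 + loginv (2 * e)) - ln (1 + loginv b)) / 2 <=
  \int[P]_(x in H) (force x * tens k0 (derive1 (cut e b)) x) +
    3 ^+ n * (2 * (C + 1)).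
Proof.
move=> e0 eb b1 C0 hC iF; have b0 : 0 < b by lra.
have C1 : 0 <= C + 1 by lra.
pose g1 t := weight t * \1_(`[2 * e, b]) t : R.
pose g2 := dyadic_bump (C + 1) e b.
have g20 t : 0 <= g2 t by exact: dyadic_bump_ge0.
have mg1 : measurable_fun [set t : R | 0 < t] g1.
  apply: measurable_funM; first exact: measurable_weight.
  exact: measurable_funTS.
have mg2 : measurable_fun setT g2 by exact: measurable_dyadic_bump.
have mb a c : measurable_fun setT (fun x : T => \1_(box a c) x.1 : R).
  by apply: measurableT_comp => //; apply: measurable_indic; exact: measurable_box.
have I2 : (\int[P]_(x in H) (\1_(box 1 4) x.1 * g2 x.2)%:E =
    (3 ^+ n * (2 * (C + 1)))%:E)%E.
  rewrite (integral_half_prod (measurable_box 1 4))//; last exact: measurable_funTS.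
  rewrite lebesgue_rV_itv_box ?ltr1n// integral_dyadic_bump//; last exact: measurable_gt0.
  by rewrite -EFinM; congr (_ ^+ n * _)%:E; ring.
have i2 : P.-integrable H (fun x => (\1_(box 1 4) x.1 * g2 x.2)%:E).
  apply/integrableP; split.
    apply/measurable_EFinP; apply: measurable_funTS; apply: measurable_funM => //.
    exact: (measurableT_comp mg2).
  under eq_integral do rewrite gee0_abs ?lee_fin ?mulr_ge0//.
  by rewrite I2 ltry.
have g10 t : 0 < t -> 0 <= g1 t.
  by move=> t0; rewrite mulr_ge0// ltW// weight_gt0.
have I1 : (((ln (1 + loginv (2 * e)) - ln (1 + loginv b)) / 2)%:E <=
    \int[P]_(x in H) (\1_(box 2 3) x.1 * g1 x.2)%:E)%E.
  rewrite (integral_half_prod (measurable_box 2 3) mg1 g10).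
  rewrite lebesgue_rV_itv_box ?ltr_nat// (_ : 3 - 2 = 1); last by ring.
  rewrite expr1n mul1e; have e20 : 0 < 2 * e by rewrite mulr_gt0.
  have b1' : b <= 1 by lra.
  apply: (le_trans (integral_weight_ge e20 eb b1')).
  rewrite le_eqVlt; apply/orP; left; apply/eqP; apply/esym.
  transitivity (\int[lam]_(t in [set t : R | (0 < t)%R])
      ((fun t : R => (weight t)%:E) \_ [set` `[(2 * e)%R, b]]) t)%E.
    apply: eq_integral => t _; rewrite /g1 patchE indicE.
    by case: (_ \in _); rewrite ?mulr1 ?mulr0.
  rewrite -integral_mkcondr; congr (integral _ _ _).
  apply/seteqP; split => t /=; first by case.
  by rewrite in_itv/= => /andP[et tb]; rewrite et tb (lt_le_trans e20).
have : (\int[P]_(x in H) (\1_(box 2 3) x.1 * g1 x.2)%:E <=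
   \int[P]_(x in H) ((force x * tens k0 (derive1 (cut e b)) x)%:E +
      (\1_(box 1 4) x.1 * g2 x.2)%:E))%E.
  apply: ge0_le_integral; first exact: mH.
  - by move=> x x0; rewrite lee_fin mulr_ge0// g10.
  - apply/measurable_EFinP; apply: measurable_funM; first exact: measurable_funTS.
    apply: (measurable_comp measurable_gt0 _ mg1); first by move=> _ [x x0 <-].
    by apply: measurable_funTS; exact: measurable_snd.
  - by have /integrableP[] := integrableD mH iF i2.
  - move=> x x0; rewrite -EFinD lee_fin.
    have w0 := weight_gt0 x0.
    have [x14|x14] := pselect (box 1 4 x.1); last first.
      have x23 : ~ box 2 3 x.1.
        by move=> h; apply: x14 => j; have /andP[h2 h3] := h j; apply/andP; lra.
      rewrite [X in X * g1 _]indicE memNset// mul0r.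
      rewrite /singular_force /tens profile_eq0// !mul0r add0r mulr_ge0//.
    have wI c : 0 < c ->
        weight x.2 * \1_(`[c, 2 * c]) x.2 <= c^-1 * \1_(`[c, 2 * c]) x.2.
      move=> c0; rewrite indicE mem_setE in_itv/=.
      have [/andP[cx _]|_] := boolP (_ && _); last by rewrite !mulr0.
      by rewrite !mulr1 (le_trans (weight_le x0))// lef_pV2 ?posrE.
    have := derive1_cut_ge e0 (ltW eb) x.2 C0 hC; have := wI _ e0; have := wI _ b0.
    have -> : force x * tens k0 (derive1 (cut e b)) x =
        eta x.1 ^+ 2 * (weight x.2 * derive1 (cut e b) x.2).
      by rewrite /singular_force /tens; ring.
    rewrite /g1 /g2 /dyadic_bump [\1_(box 1 4) _]indicE mem_set// mul1r.
    have : eta x.1 ^+ 2 <= 1 by rewrite expr_le1 ?profile0_le1 ?profile0_ge0.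
    have : \1_(box 2 3) x.1 <= eta x.1 ^+ 2.
      rewrite indicE; have [x23|x23] := boolP (x.1 \in box 2 3); last exact: sqr_ge0.
      by rewrite profile0_eq1 ?expr1n//; move: x23; rewrite inE.
    have := w0; have : 0 <= eta x.1 ^+ 2 by exact: sqr_ge0.
    have i0 (D : set R) : 0 <= \1_D x.2 :> R by [].
    have := i0 `[2 * e, b]%classic; have := i0 `[e, 2 * e]%classic.
    have := i0 `[b, 2 * b]%classic.
    move: (\1_`[2 * e, b] x.2) (\1_`[e, 2 * e] x.2) (\1_`[b, 2 * b] x.2)
      (weight x.2) (eta x.1 ^+ 2) (\1_(box 2 3) x.1) (derive1 (cut e b) x.2).
    (* [I], [J], [L] are the indicators of [[2 e, b]], [[e, 2 e]], [[b, 2 b]]; [w] is the weight,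
       [y] is [eta ^ 2], [z] the indicator of [box 2 3] and [q] the slope of the cut. The chain is
       [z w I <= y w I <= y w (q + (C + 1)(J + L)) <= y w q + (C + 1)(J / e + L / b)]. *)
    move=> I J L w y z q L0 J0 I0 y0 {}w0 zy y1 wL wJ hq.
    have h1 : z * (w * I) <= y * (w * I) by rewrite ler_wpM2r// mulr_ge0// ltW.
    have h2 : y * (w * I) <= y * (w * (q + ((C + 1) * J + (C + 1) * L))).
      by rewrite ler_wpM2l// ler_wpM2l// ltW.
    have h3 : y * (w * ((C + 1) * J + (C + 1) * L)) <=
        w * ((C + 1) * J + (C + 1) * L).
      by rewrite ler_piMl// mulr_ge0 ?(ltW w0)// addr_ge0// mulr_ge0.
    have h4 : (C + 1) * (w * J) <= (C + 1) * (e^-1 * J) by rewrite ler_wpM2l.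
    have h5 : (C + 1) * (w * L) <= (C + 1) * (b^-1 * L) by rewrite ler_wpM2l.
    nra.
rewrite (integralD mH iF i2) => h.
have fI := integrable_fin_num mH iF.
have := le_trans I1 h; rewrite I2 -(fineK fI) -EFinD lee_fin.
exact.
Qed.

Lemma no_distribution_limit (p beta : R) (u v : T -> R) F f : 1 < p ->
  p - 1 <= beta < 2 * p - 1 -> weighted_Lp p beta u ->
  (forall j, weighted_Lp p beta (F j)) -> weighted_Lp p beta f ->
  weak_solution u F force f -> Lp_continuous_version p u v ->
  ~ has_distribution_limit_at0 (slice v).
Proof.
move=> p1 hb Lu LF Lf ws uv lv.
have [_ b2] := andP hb.
have Lforce := @weighted_Lp_singular_force R n _ _ p1 hb.
have [M [dl [M0 dl0 haeM]]] := average_bounded_near0 Lu uv lv.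
have [C C1 hC] := @ramp_bounds R; have C0 : 0 <= C by lra.
(* [2 * b <= 1] keeps the test functions where the first moment lives, and [2 * b < dl] keeps them
   where the averages of [u] are bounded. *)
pose b := Num.min (2^-1) (dl / 3).
have b0 : 0 < b by rewrite lt_min invr_gt0 ltr0n divr_gt0.
have b21 : 2 * b <= 1.
  have : b <= 2^-1 by rewrite ge_min lexx.
  lra.
have bdl : 2 * b < dl.
  have : b <= dl / 3 by rewrite ge_min lexx orbT.
  lra.
pose mass (w : T -> R) := \int[P]_(x in H) (`|w x| * first_moment x).
have /choice[K hK] : forall k : 'I_n -> nat, exists B : R,
    0 <= B /\ forall x, `|profile k x| <= B.
  by move=> k; have [B B0 kB] := @profile_bounded R n k; exists B.
(* Bounds for the second-order terms. Tangential derivatives fall on [eta] and leave a moment of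
   [u]; in the normal direction the averages, at most [M], meet [cut''], of L^1 norm at most
   [2 * C]. *)
pose dd (i : 'I_n.+1) :=
  if unlift ord_max i is Some j then K (incr (incr k0 j) j) * mass u
  else M * (2 * C).
pose bound := \sum_i dd i + K k0 * mass u
  + \sum_(j < n) K (incr k0 j) * mass (F j)
  + K k0 * mass f.
have key e : 0 < e -> 2 * e < b ->
  \int[P]_(x in H) (force x * tens k0 (derive1 (cut e b)) x) <= bound.
  move=> e0 eb.
  have eb' : 2 * e <= b by exact: ltW.
  have cut0 s : ~ (e <= s <= 2 * b) -> cut e b s = 0.
    move/negP; rewrite negb_and -!ltNge => h; apply: cut_eq0 => //.
    by case/orP: h => /ltW; [left|right].
  have Cc := @Coo_cut R e b.
  have mcut : measurable_fun setT (cut e b).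
    by apply: continuous_measurable_fun; exact: Coo_continuousT.
  have mtens k : measurable_fun setT (tens k (cut e b) : T -> R).
    exact: measurable_tensT.
  have cutm k x : H x -> `|tens k (cut e b) x| <= K k * first_moment x.
    move=> x0; rewrite -[K k]mulr1; apply: tens_le_moment x0 => //.
      exact: (hK k).2.
    move=> t t0; rewrite mul1r indicE mem_setE in_itv/= t0/=.
    have [t1|t1] := leP t 1; first by rewrite mulr1 cut_le// ltW.
    rewrite cut0 ?normr0 ?mulr0// => /andP[_ tb].
    by move: t1; rewrite ltNge (le_trans tb).
  have Lp_bound w k : weighted_Lp p beta w ->
      `|\int[P]_(x in H) (w x * tens k (cut e b) x)| <= K k * mass w.
    by move=> Lw; apply: (Rintegral_moment_le p1 b2 Lw) => //; exact: cutm.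
  rewrite (@weak_solution_identity _ _ _ _ _ e0 b21 Cc cut0 _ _ _ _ _ _ _ p1 b2
    Lu LF Lforce Lf ws).
  have dd_bound i : `|\int[P]_(x in H) (u x *
      'D_(half_basis i) ('D_(half_basis i) (tens k0 (cut e b))) x)| <= dd i.
    rewrite /dd; case: unliftP => [j ->|->].
      rewrite (@eq_Rintegral _ _ _ _ _
          (fun x => u x * tens (incr (incr k0 j) j) (cut e b) x)).
        exact: Lp_bound.
      by move=> x _; rewrite derive_tens_tangential -(derive_tens_tangential (incr k0 j)).
    rewrite (@eq_Rintegral _ _ _ _ _
        (fun x => u x * tens k0 (derive1 (derive1 (cut e b))) x)); last first.
      move=> x _; rewrite derive_tens_normal//.
      by rewrite -(derive_tens_normal k0 (Coo_derive openT Cc)).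
    have d2b t : `|derive1 (derive1 (cut e b)) t| <= dyadic_bump C e b t.
      exact: derive2_cut_le.
    have md2 : measurable_fun setT (derive1 (derive1 (cut e b))).
      apply: continuous_measurable_fun; apply: Coo_continuousT.
      by apply: Coo_derive openT _; apply: Coo_derive openT Cc.
    rewrite -lee_fin.
    (* This [A] blows up as [e] tends to 0, harmlessly: the resulting estimate only involves the L^1
       norm of [cut'']. *)
    apply: (le_trans (normal_average_le (A := C / e + C / b) p1 b2 Lu e0 b21 bdl M0
      haeM md2 _)).
      move=> t; have [teb|teb] := pselect (is_true (e <= t <= 2 * b)); last first.
        have := @derive1n_support _ _ _ _ 2 t cut0 teb; rewrite /derive1n/= => ->.
        by rewrite normr0 mulr_ge0// addr_ge0// divr_ge0// ltW.
      rewrite indicE mem_setE in_itv/= teb mulr1 (le_trans (d2b t))//.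
      by apply: lerD; rewrite ler_piMr ?divr_ge0 ?(ltW e0) ?(ltW b0)// indicE
        lern1 leq_b1.
    rewrite EFinM -(@integral_dyadic_bump setT C e b)// -ge0_integralZl//; last 2 first.
    - by apply/measurable_EFinP; exact: measurable_dyadic_bump.
    - by move=> t _; rewrite lee_fin dyadic_bump_ge0.
    apply: ge0_le_integral => //.
    - by move=> t _; rewrite lee_fin mulr_ge0.
    - by apply/measurable_EFinP; apply: measurable_funM => //; exact: measurableT_comp.
    - apply/measurable_EFinP; apply: measurable_funM => //.
      exact: measurable_dyadic_bump.
    - by move=> t _; rewrite lee_fin ler_wpM2l.
  rewrite /bound; apply: lerD; last first.
    by rewrite (le_trans (ler_norm _))// normrN Lp_bound.
  apply: lerD; last first.
    rewrite (le_trans (ler_norm _))// normrN (le_trans (ler_norm_sum _ _ _))//.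
    by apply: ler_sum => j _; exact: Lp_bound.
  apply: lerD; last by rewrite (le_trans (ler_norm _))// Lp_bound.
  rewrite (le_trans (ler_norm _))// normrN (le_trans (ler_norm_sum _ _ _))//.
  by apply: ler_sum => i _; exact: dd_bound.
(* The threshold is set so that, once [2 * e <= a], the lower bound for the force term exceeds
   [bound] by at least 1 even after the error [3 ^+ n * (2 * (C + 1))] is subtracted. *)
have [a a0 ha] := loginv_unbounded
  (2 * (bound + 3 ^+ n * (2 * (C + 1)) + 1) + ln (1 + loginv b)).
(* The divisor 4 yields [2 * e <= a] together with the strict [2 * e < b]. *)
pose e := Num.min a b / 4.
have e0 : 0 < e by rewrite divr_gt0// lt_min a0.
have ea : 2 * e <= a.
  have : Num.min a b <= a by rewrite ge_min lexx.
  rewrite /e; lra.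
have eb : 2 * e < b.
  have : Num.min a b <= b by rewrite ge_min lexx orbT.
  rewrite /e; lra.
have Cc := @Coo_cut R e b.
have iF : P.-integrable H (fun x => (force x * tens k0 (derive1 (cut e b)) x)%:E).
  apply: (admissible_integrable_Lp e0 b21 Cc _ p1 b2 _ Lforce).
    move=> s /negP; rewrite negb_and -!ltNge => h; apply: cut_eq0 => //; first exact: ltW.
    by case/orP: h => /ltW; [left|right].
  by exists k0, 1%N.
have := singular_force_lower e0 eb b21 C0 hC iF.
have := key e e0 eb.
have := ha (2 * e) (mulr_gt0 (ltr0n _ _ : 0 < 2%:R) e0) ea.
lra.
Qed.

End contradiction.

Theorem proposition1p2 (R : realType) (d : nat) (p beta : R)
    (hd : (2 <= d)%N) (hp : 1 < p) (hbeta : p - 1 <= beta < 2 * p - 1) :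
  exists Fd : 'rV[R]_d.-1 * R -> R,
    [/\ weighted_Lp p beta Fd,
        smooth_on half_basis half_space Fd
      & forall u : 'rV[R]_d.-1 * R -> R,
          weighted_W1p p beta u ->
          (exists (F : 'I_d.-1 -> 'rV[R]_d.-1 * R -> R)
                  (f : 'rV[R]_d.-1 * R -> R),
             [/\ forall j, weighted_Lp p beta (F j),
                 weighted_Lp p beta f
               & weak_solution u F Fd f]) ->
          forall v : 'rV[R]_d.-1 * R -> R, Lp_continuous_version p u v ->
            ~ has_distribution_limit_at0 (slice v)].
Proof.
exists singular_force; split.
- exact: weighted_Lp_singular_force.
- exact: smooth_singular_force.
- move=> u [Lu _] [F [f [LF Lf ws]]] v uv.
  exact: no_distribution_limit hp hbeta Lu LF Lf ws uv.
Qed.
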